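(* Let $k\ge2$, $0<p<1$, $1\le\ell\le k-1$, and let $\pi=k_1+\dots+k_t$ be a proper partition of $k$. Then: (1) $\mathrm{CliqueDisc}_p[\ell]\Rightarrow\mathrm{Expand}_p[\pi]$ if and only if $k_i\le\ell$ for all $i$; (2) $\mathrm{Expand}_p[\pi]\Rightarrow\mathrm{CliqueDisc}_p[1]$ (for every proper partition $\pi$ of $k$); (3) if $\ell\ge2$, then $\mathrm{Expand}_p[\pi]\not\Rightarrow\mathrm{CliqueDisc}_p[\ell]$ (for every proper partition $\pi$ of $k$). Here $P\Rightarrow Q$ means that every sequence $\{H_n\}_{n\to\infty}$ of $k$-uniform hypergraphs with $|V(H_n)|=n$ satisfying $P$ also satisfies $Q$, and $P\not\Rightarrow Q$ means that some such sequence satisfies $P$ but not $Q$.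
   Context: A $k$-uniform hypergraph $H$ is a pair of finite sets $(V(H),E(H))$ where $E(H)$ is a collection of $k$-subsets of $V(H)$. A proper partition $\pi=k_1+\dots+k_t$ of $k$ is an unordered list of at least two positive integers whose sum is $k$. Let $0<p<1$ be a fixed real and $\{H_n\}_{n\to\infty}$ a sequence of $k$-uniform hypergraphs with $|V(H_n)|=n$. $\mathrm{Expand}_p[\pi]$, for $\pi=k_1+\dots+k_t$: for all $S_i\subseteq\binom{V(H_n)}{k_i}$, $1\le i\le t$, $e(S_1,\dots,S_t)=p\prod_{i=1}^t|S_i|+o(n^k)$, where $e(S_1,\dots,S_t)$ is the number of tuples $(s_1,\dots,s_t)$ with $s_i\in S_i$ for all $i$ and $s_1\cup\dots\cup s_t\in E(H_n)$. $\mathrm{CliqueDisc}_p[\ell]$, for $1\le\ell\le k-1$: for every $\ell$-uniform hypergraph $G$ with $V(G)=V(H_n)$, $|E(H_n)\cap\mathcal{K}_k(G)|=p|\mathcal{K}_k(G)|+o(n^k)$, where $\mathcal{K}_k(G)$ is the collection of $k$-sets $T\subseteq V(G)$ all of whose $\ell$-subsets are edges of $G$. The $o(n^k)$ terms are uniform: there is $f:\mathbb{N}\to\mathbb{R}$ with $f(n)/n^k\to0$ bounding the absolute error for all $n$ and all choices of the sets $S_i$ (respectively of $G$). *)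

(* Defs.v *)
From HB Require Import structures.
From mathcomp Require Import all_boot all_order all_algebra.
From mathcomp Require Import boolp classical_sets reals topology normedtype sequences.
Set Implicit Arguments.
Unset Strict Implicit.
Unset Printing Implicit Defensive.
Import Order.TTheory GRing.Theory Num.Theory.
Import numFieldNormedType.Exports.
Local Open Scope ring_scope.

Definition ksets (V : finType) (k : nat) : {set {set V}} :=
  [set A : {set V} | #|A| == k]%SET.

Record hypergraph (k : nat) (V : finType) := Hypergraph {
  edges : {set {set V}};
  edges_uniform : edges \subset ksets V k
}.

Record hypergraph_seq (k : nat) := HypergraphSeq {
  vertices : nat -> finType;
  card_vertices : forall n, #|vertices n| = n;
  graph : forall n, hypergraph k (vertices n)
}.

(* Partitions are unordered; a list of parts represents one up to permutation,
   and Expand below does not depend on the order chosen. *)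
Definition proper_partition (k : nat) (pi : seq nat) : bool :=
  [&& (1 < size pi)%N, all (fun ki => 0 < ki)%N pi & sumn pi == k].

Definition edge_tuples (k t : nat) (V : finType) (H : hypergraph k V)
    (S : 'I_t -> {set {set V}}) : {set {ffun 'I_t -> {set V}}} :=
  [set s : {ffun 'I_t -> {set V}} |
     [forall i, s i \in S i] && ((\bigcup_(i < t) s i)%SET \in edges H)]%SET.

Definition cliques (k l : nat) (V : finType) (G : hypergraph l V) :
    {set {set V}} :=
  [set T in ksets V k |
     [forall A in ksets V l, (A \subset T) ==> (A \in edges G)]]%SET.

Section Properties.
Variables (R : realType) (k : nat) (p : R).
Implicit Type H : hypergraph_seq k.

Definition is_little_o_pow (f : nat -> R) : Prop :=
  ((fun n : nat => f n / n%:R ^+ k) @ \oo --> (0 : R))%classic.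

Definition Expand (pi : seq nat) H : Prop :=
  exists2 f : nat -> R, is_little_o_pow f &
    forall (n : nat) (S : 'I_(size pi) -> {set {set vertices H n}}),
      (forall i, S i \subset ksets (vertices H n) (nth 0%N pi i)) ->
      `| #|edge_tuples (graph H n) S|%:R
         - p * \prod_(i < size pi) #|S i|%:R | <= f n.

Definition CliqueDisc (l : nat) H : Prop :=
  exists2 f : nat -> R, is_little_o_pow f &
    forall (n : nat) (G : hypergraph l (vertices H n)),
      `| #|edges (graph H n) :&: cliques k G|%:R
         - p * #|cliques k G|%:R | <= f n.

End Properties.

Definition seq_implies (k : nat) (P Q : hypergraph_seq k -> Prop) : Prop :=
  forall H, P H -> Q H.

Definition seq_not_implies (k : nat) (P Q : hypergraph_seq k -> Prop) : Prop :=
  exists H, P H /\ ~ Q H.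

Arguments seq_implies : clear implicits.
Arguments seq_not_implies : clear implicits.

(* Main.v *)
Require Import Defs.
From mathcomp Require Import all_boot all_order all_algebra.
From mathcomp Require Import boolp reals topology normedtype sequences exp.
From mathcomp Require Import ring lra zify.
Set Implicit Arguments.
Unset Strict Implicit.
Unset Printing Implicit Defensive.
Import Order.TTheory GRing.Theory Num.Theory.
Import numFieldNormedType.Exports.
Local Open Scope ring_scope.

(** Both properties compare the edge set of [H] with [p] times the complete
    hypergraph, tested against a family of functions on the k-sets of vertices.
    It is convenient to test on ordered tuples: for an index set [K] of size [k]
    cut into blocks of sizes k_1, ..., k_t, and an injective tuple
    x : K -> V, the test of [Expand] is that the image of the i-th block lies in
    [S i], and the test of [CliqueDisc p l] is that the l-subsets of the image of
    [x] lie in [G].  The tuples of sets that are not disjoint contribute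
    only O(n^(k-1)) ([expand_tuples]).

    Implications.  The key is [colouring_disc]: if a weight [h] on k-sets has
    small sums over the k-cliques of every l-graph, then it has small sums
    against every product, over the subsets A of K with at most [l] elements,
    of indicators [x @: A \in F A].  Colour the vertices by [K]; for a fixed
    colouring, the transversal k-sets that satisfy the constraints (read through the
    colours) are a signed combination, by inclusion-exclusion over the
    sets of allowed colours, of clique families of l-graphs; averaging over the
    colourings reaches every injective tuple equally often.  When all k_i <= l,
    the test of [Expand] is such a product, so [CliqueDisc p l] gives [Expand].
    Conversely, the sets [S i] of all k_i-subsets of [U] turn [Expand] into the test
    that defines [CliqueDisc p 1].

    Counterexamples.  Both use the same device: hypergraphs that look random
    with a prescribed edge density [w] ([exists_disc]).  They come from a
    union bound for exponential moments ([union_bound]), applied to the at most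
    2^(n^(m-1)) clique tests; the random choice is replaced
    by the method of conditional expectations ([choose_bits]).  With
    [w T = p + e * u T] for a function [u] bounded by 1, the deviation of the
    hypergraph from density [p] against a test is [e] times the correlation of [u]
    with this test, up to a small error.

    - If some k_i = m > l, take for [u T] a random sign of the m-set [T :&: X]
      when [X] meets [T] in m points, and 0 otherwise.  For fixed [T :\: X], a
      clique test of an l-graph becomes an (m-1)-clique test of [T :&: X], which
      does not correlate with the random sign ([marked_disc]); but
      letting [S i] be the positive m-subsets of [X] and the other [S j] all
      k_j-subsets outside [X], [u] is 1 on all disjoint tuples.
    - For l >= 2, let [u T] be the product over the pairs in [T] of random
      signs.  A pair with its points in two different blocks makes the test of
      [Expand] a bilinear form of the sign matrix, hence small
      ([pair_product_blocks]).  If [CliqueDisc p l] held, then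
      expanding each sign as 2 * indicator - 1 and applying [colouring_disc]
      would make the sum of [u] times the deviation small; but that sum is
      about [e] times the sum of u^2, which is e * n^k ([expand_not_clique_disc]).

    All error terms, other than those given by the hypotheses, are bounded by a
    multiple of n^k / sqrt n ([rate]). *)

(** * Ordered tuples of vertices *)

Section Tuples.
Context (K V : finType).
Implicit Types (x : {ffun K -> V}) (a b : K) (v : V).

Definition im x : {set V} := x @: [set: K].

Lemma card_im x : injectiveb x -> #|im x| = #|K|.
Proof. by move/injectiveP=> ix; rewrite card_imset // cardsT. Qed.

Lemma card_im_inj x : #|im x| = #|K| -> injectiveb x.
Proof.
move=> e; have /imset_injP ix : #|x @: [set: K]| == #|[set: K]| by rewrite cardsT -e.
by apply/injectiveP => a b; apply: ix; rewrite inE.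
Qed.

Definition upd x a v : {ffun K -> V} := [ffun j => if j == a then v else x j].

Lemma upd_same x a v : upd x a v a = v.
Proof. by rewrite ffunE eqxx. Qed.

Lemma upd_other x a v j : j != a -> upd x a v j = x j.
Proof. by rewrite ffunE => /negPf->. Qed.

Lemma upd_upd x a v v' : upd (upd x a v) a v' = upd x a v'.
Proof. by apply/ffunP => j; rewrite !ffunE; case: eqP. Qed.

Lemma upd_id x a : upd x a (x a) = x.
Proof. by apply/ffunP => j; rewrite !ffunE; case: eqP => // ->. Qed.

Lemma updC x a b v v' : a != b ->
  upd (upd x a v) b v' = upd (upd x b v') a v.
Proof.
move=> ab; apply/ffunP => j; rewrite !ffunE.
by case: (eqVneq j b) => // ->; rewrite eq_sym (negPf ab).
Qed.

Lemma upd_imset x a v (A : {set K}) : a \notin A -> upd x a v @: A = x @: A.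
Proof.
move=> aA; apply: eq_in_imset => j jA; apply: upd_other.
by apply: contraNneq aA => <-.
Qed.

(** Resampling one coordinate of all tuples hits every tuple equally often,
    because exchanging the new value with the old one is an involution. *)
Lemma sum_upd (R : nmodType) (f : {ffun K -> V} -> R) a :
  \sum_x \sum_v f (upd x a v) = (\sum_x f x) *+ #|V|.
Proof.
pose swap (u : {ffun K -> V} * V) := (upd u.1 a u.2, u.1 a).
have swapK : involutive swap.
  by case=> x v; rewrite /swap /= upd_upd upd_same upd_id.
rewrite pair_big /= (reindex_inj (inv_inj swapK)) /=.
under eq_bigr do rewrite upd_upd upd_id.
rewrite -(pair_big xpredT xpredT (fun x _ => f x)) /= -sumrMnl.
by apply: eq_bigr => x _; rewrite sumr_const.
Qed.

(** A non-injective tuple has a collision at some pair of indices, and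
    resampling one of these two coordinates shows that a collision at a given
    pair has frequency [1 / #|V|]. *)
Lemma card_noninjective :
  (#|V| * #|[set x : {ffun K -> V} | ~~ injectiveb x]|
     <= #|K| ^ 2 * #|V| ^ #|K|)%N.
Proof.
have count a b : a != b ->
    (\sum_(x : {ffun K -> V}) (x a == x b) * #|V| = #|V| ^ #|K|)%N.
  move=> ab; have := sum_upd (fun x : {ffun K -> V} => (x a == x b : nat)) a.
  rewrite -mulr_natr natn mulr_suml => <-; rewrite -card_ffun -sum1_card.
  apply: eq_bigr => x _.
  rewrite (bigD1 (x b)) //= upd_same upd_other 1?eq_sym // eqxx big1 // => v vb.
  by rewrite upd_same upd_other 1?eq_sym // eq_sym (negPf vb).
rewrite mulnC -sum1dep_card big_distrl /=.
apply: (@leq_trans (\sum_(x : {ffun K -> V}) \sum_(u : K * K | u.1 != u.2)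
    (x u.1 == x u.2) * #|V|))%N.
  rewrite [leqRHS](bigID (fun x : {ffun K -> V} => ~~ injectiveb x)) /=.
  apply: leq_trans (leq_addr _ _); apply: leq_sum => x /injectivePn[a [b ab e]].
  by rewrite (bigD1 (a, b)) //= e eqxx leq_addr.
rewrite exchange_big /= (eq_bigr (fun=> (#|V| ^ #|K|)%N)); last first.
  by case=> a b /= ab; exact: count.
rewrite sum_nat_const leq_mul2r; apply/orP; right.
by rewrite -mulnn -card_prod; apply: max_card.
Qed.

End Tuples.

Section Blocks.
Context (K V I : finType) (gamma : K -> I).
Implicit Types (x : {ffun K -> V}) (s : I -> {set V}).

Definition block i := [set j | gamma j == i].

Lemma bigcup_block x : \bigcup_i (x @: block i) = im x.
Proof.
apply/setP => v; apply/bigcupP/imsetP => [[i _ /imsetP[j _ ->]]|[j _ ->]].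
  by exists j.
by exists (gamma j) => //; apply: imset_f; rewrite inE.
Qed.

(** Block by block, match the enumeration of the block with that of its target.
    The targets may overlap: this is how overlapping tuples of sets
    are bounded by non-injective tuples of vertices. *)
Lemma exists_tuple s : (forall i, #|s i| = #|block i|) ->
  exists x, forall i, x @: block i = s i.
Proof.
move=> cs; have [v0 _|noV] := pickP (mem [set: V]); last first.
  have noK (j : K) : False.
    have s0 : #|s (gamma j)| = 0%N.
      by apply: eq_card0 => v; have := noV v; rewrite /= in_setT.
    have /card0_eq/(_ j) : #|block (gamma j)| = 0%N by rewrite -cs.
    by rewrite !inE eqxx.
  exists [ffun j => False_rect V (noK j)] => i.
  have -> : s i = set0 by apply/setP => v; have := noV v; rewrite /= in_setT.
  by apply/setP => v; rewrite inE; apply/negbTE/imsetP => -[j]; case: (noK j).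
exists [ffun j => nth v0 (enum (s (gamma j))) (index j (enum (block (gamma j))))].
move=> i; set x := finfun _.
have xE j : j \in block i -> x j = nth v0 (enum (s i)) (index j (enum (block i))).
  by rewrite inE ffunE => /eqP->.
have idx j : j \in block i -> (index j (enum (block i)) < size (enum (s i)))%N.
  by move=> ji; rewrite -cardE cs cardE index_mem mem_enum.
apply/eqP; rewrite eqEcard cs card_in_imset ?leqnn ?andbT.
  apply/subsetP => _ /imsetP[j ji ->]; rewrite xE //.
  by rewrite -mem_enum mem_nth // idx.
move=> j j' ji ji'; rewrite !xE // => /eqP; rewrite nth_uniq ?enum_uniq ?idx //.
by move/eqP => e; rewrite -(nth_index j (_ : j \in enum (block i))) ?mem_enum // e
  nth_index ?mem_enum.
Qed.

(** These maps are the permutations that preserve every block, so their number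
    is the product of the factorials of the block sizes. *)
Definition block_symmetries :=
  [set t : {ffun K -> K} | [forall i, t @: block i == block i]].

Lemma block_symmetries_gt0 : (0 < #|block_symmetries|)%N.
Proof.
apply/card_gt0P; exists [ffun j => j]; rewrite inE; apply/forallP => i.
by rewrite (eq_imset (g := id)) ?imset_id // => j; rewrite ffunE.
Qed.

(** If [x0] induces the tuple of sets [s], then the other tuples inducing [s] are
    the compositions of [x0] with a block symmetry; in particular their number does
    not depend on [s]. *)
Lemma card_tuples s : (forall i, #|s i| = #|block i|) ->
    #|\bigcup_i s i| = #|K| ->
  #|[set x : {ffun K -> V} | [forall i, x @: block i == s i]]| = #|block_symmetries|.
Proof.
move=> cs cU; have [x0 x0E] := exists_tuple cs.
have /injectiveP ix0 : injectiveb x0.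
  by apply: card_im_inj; rewrite -cU -bigcup_block (eq_bigr s).
pose comp (t : {ffun K -> K}) : {ffun K -> V} := [ffun j => x0 (t j)].
have icomp : injective comp.
  by move=> t u /ffunP e; apply/ffunP => j; have := e j; rewrite !ffunE => /ix0.
have compE t i : comp t @: block i = x0 @: (t @: block i).
  by rewrite -imset_comp; apply: eq_imset => j; rewrite ffunE.
rewrite -(card_imset _ icomp); apply: eq_card => x; rewrite inE.
apply/forallP/imsetP => [xs|[t]]; last first.
  rewrite inE => /forallP ts -> i; rewrite compE (eqP (ts i)).
  by apply/eqP/x0E.
have /fin_all_exists[t tE] (j : K) : exists j', x j = x0 j'.
  have : x j \in s (gamma j) by rewrite -(eqP (xs _)); apply: imset_f; rewrite inE.
  by rewrite -x0E => /imsetP[j' _ ->]; exists j'.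
have xE : x = comp [ffun j => t j].
  by apply/ffunP => j; rewrite !ffunE.
exists [ffun j => t j] => //; rewrite inE; apply/forallP => i.
apply/eqP/(imset_inj ix0); rewrite -compE -xE x0E; exact/eqP.
Qed.

End Blocks.

Lemma card_tuples_onto (K V : finType) (T : {set V}) : #|T| = #|K| ->
  #|[set x : {ffun K -> V} | im x == T]| = #|K|`!.
Proof.
move=> cT; rewrite -ffactnn -{1}cT.
have := card_inj_ffuns_on K (mem T) => <-.
apply: eq_card => x; rewrite !inE; apply/eqP/andP => [e|[/ffun_onP xT xi]].
  split; last by apply: card_im_inj; rewrite e.
  by apply/ffun_onP => j; rewrite -[T]e imset_f ?inE.
apply/eqP; rewrite eqEcard card_im // cT leqnn andbT.
by apply/subsetP => _ /imsetP[j _ ->]; apply: xT.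
Qed.

Lemma sum_injective_im (R : pzRingType) (K V : finType) (f : {set V} -> R) :
  \sum_(x : {ffun K -> V} | injectiveb x) f (im x)
    = (#|K|`!)%:R * \sum_(T in ksets V #|K|) f T.
Proof.
rewrite (partition_big (@im K V) (mem (ksets V #|K|))) /=; last first.
  by move=> x /card_im e; rewrite inE e.
rewrite mulr_sumr; apply: eq_bigr => T; rewrite inE => /eqP cT.
rewrite -(card_tuples_onto cT) mulr_natl -sumr_const.
apply: eq_big => [x|x /andP[_ /eqP->]//]; rewrite inE andbC.
by case: eqP => //= e; rewrite card_im_inj // e.
Qed.

(** The indices enumerate the disjoint union of the ordinals ['I_(nth 0 s i)], and
    the block of an index is its tag. *)
Lemma exists_blocks (s : seq nat) : exists gamma : 'I_(sumn s) -> 'I_(size s),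
  forall i, #|block gamma i| = nth 0%N s i.
Proof.
pose T := {i : 'I_(size s) & 'I_(nth 0%N s i)}.
have cT : #|{: T}| = sumn s.
  rewrite card_tagged; congr sumn; apply: (@eq_from_nth _ 0%N).
    by rewrite size_map size_enum_ord.
  move=> i; rewrite size_map size_enum_ord => i_lt.
  by rewrite (nth_map (Ordinal i_lt)) ?size_enum_ord // card_ord nth_enum_ord.
exists (fun j => tag (enum_val (cast_ord (esym cT) j))) => i.
pose f (u : T) : 'I_(sumn s) := cast_ord cT (enum_rank u).
have fK u : enum_val (cast_ord (esym cT) (f u)) = u.
  by rewrite /f cast_ordK enum_rankK.
rewrite -[RHS]card_ord.
rewrite -(card_imset _ (f := fun j : 'I_(nth 0%N s i) =>
  f (Tagged (fun i : 'I_(size s) => 'I_(nth 0%N s i)) j))); last first.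
  move=> j j' e; have := congr1 (fun j => enum_val (cast_ord (esym cT) j)) e.
  by rewrite !fK => /eqP; rewrite eq_Tagged => /eqP.
apply: eq_card => j; rewrite inE; apply/eqP/imsetP => [<-|[j' _ ->]].
  exists (tagged (enum_val (cast_ord (esym cT) j))) => //.
  by rewrite taggedK /f enum_valK cast_ordKV.
by rewrite fK.
Qed.

Lemma block_lt (k t : nat) (gamma : 'I_k -> 'I_t) :
  (1 < t)%N -> (forall i, 0 < #|block gamma i|)%N ->
  forall i, (#|block gamma i| <= k.-1)%N.
Proof.
move=> t1 g0 i; have [i' ii'] : exists i' : 'I_t, i' != i.
  have : (0 < #|predC1 i|)%N by rewrite cardC1 card_ord; case: t t1 {gamma g0 i} => [|[]].
  by move=> /card_gt0P[i' ii']; exists i'.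
have /card_gt0P[j] := g0 i'; rewrite inE => /eqP ji'.
have : (#|block gamma i| < #|'I_k|)%N.
  rewrite -cardsT; apply: proper_card; rewrite properEneq subsetT andbT.
  by apply: contraNneq ii' => e; have : j \in block gamma i; [rewrite e inE|rewrite inE ji'].
by rewrite card_ord => lt; rewrite -ltnS prednK // (leq_trans _ lt).
Qed.

(** * Cliques and random colourings *)

Lemma exists_between (V : finType) (A T : {set V}) m :
  A \subset T -> (#|A| <= m)%N -> (m <= #|T|)%N ->
  exists B : {set V}, [/\ A \subset B, B \subset T & #|B| = m].
Proof.
move=> AT; elim: m => [|m IH] Am mT.
  by exists A; split=> //; apply/eqP; rewrite -leqn0.
move: Am; rewrite leq_eqVlt => /orP[/eqP e|]; first by exists A.
rewrite ltnS => /IH/(_ (ltnW mT))[B [AB BT cB]].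
have /subsetPn[v vT vB] : ~~ (T \subset B).
  by apply: contraL mT => /subset_leq_card; rewrite cB -leqNgt.
exists (v |: B); split.
- exact: subset_trans AB (subsetU1 _ _).
- by rewrite subUset sub1set vT.
- by rewrite cardsU1 vB cB.
Qed.

Lemma card_ksets_le (V : finType) m : (#|ksets V m| <= #|V| ^ m)%N.
Proof.
rewrite card_draws; apply: (@leq_trans (#|V| ^_ m)).
  by rewrite -bin_ffact leq_pmulr ?fact_gt0.
elim: m => // m IH; rewrite ffactnSr expnSr; apply: leq_mul IH _.
exact: leq_subr.
Qed.

(** [G] is any family of sets instead of an l-uniform hypergraph; its members of
    other sizes are ignored, which spares a proof of uniformity for each family. *)
Definition clique (V : finType) (l : nat) (G : {set {set V}}) (T : {set V}) :=
  [forall (A : {set V} | A \in ksets V l), (A \subset T) ==> (A \in G)].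

Lemma cliqueP (V : finType) (l : nat) (G : {set {set V}}) (T : {set V}) :
  reflect (forall A : {set V}, #|A| = l -> A \subset T -> A \in G) (clique l G T).
Proof.
apply: (iffP forall_inP) => [H A cA AT|H A].
  by apply: (implyP (H A _)) => //; rewrite inE cA.
by rewrite inE => /eqP cA; apply/implyP; apply: H.
Qed.

Section Booleans.
Context (R : comNzRingType) (J : finType).

Lemma prod_bool (b : J -> bool) :
  \prod_j (b j)%:R = [forall j, b j]%:R :> R.
Proof.
have -> : [forall j, b j] = \big[andb/true]_j b j by rewrite big_andE.
by elim/big_ind2: _ => // x b1 y b2 -> ->; rewrite -natrM mulnb.
Qed.

(** Inclusion-exclusion, obtained by expanding the product over all [j] of
    [1 - (j \notin A)]. *)
Lemma full_set_sum (A : {set J}) :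
  (A == setT)%:R = \sum_(I : {set J}) (-1) ^+ #|~: I| * (A \subset I)%:R :> R.
Proof.
have -> : (A == setT)%:R = \prod_j (1 + - (j \notin A)%:R) :> R.
  rewrite (eq_bigr (fun j => (j \in A)%:R)) => [|j _]; last first.
    by case: (j \in A); rewrite /= ?subr0 ?subrr.
  rewrite prod_bool; congr (nat_of_bool _)%:R.
  by apply/eqP/forallP => [-> j|H]; rewrite ?inE //; apply/setP => j; rewrite H inE.
rewrite bigA_distr; apply: eq_bigr => I _.
rewrite (eq_bigr (fun j => (if j \in ~: I then -1 else 1) *
    ((j \in A) ==> (j \in I))%:R)) => [|j _]; last first.
  by rewrite inE; case: (j \in I); case: (j \in A);
     rewrite /= ?mul1r ?mulr1 ?mulr0 ?oppr0.
rewrite big_split /= prod_bool -big_mkcond prodr_const /=.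
congr (_ * (nat_of_bool _)%:R).
by apply/forallP/subsetP => H j; [move=> jA; apply: (implyP (H j))
  | apply/implyP/H].
Qed.

End Booleans.

Section Colouring.
Context (R : realFieldType) (K V : finType) (l : nat) (h : {set V} -> R) (d : R).
Context (F : {set K} -> {set {set V}}).
Hypothesis l_gt0 : (0 < l)%N.
Hypothesis l_le : (l <= #|K|)%N.
Hypothesis h_disc : forall G : {set {set V}},
  `|\sum_(T in ksets V #|K|) h T * (clique l G T)%:R| <= d.

Let k := #|K|.
Implicit Types (c : {ffun V -> K}) (x : {ffun K -> V}) (I : {set K}) (T : {set V}).

Let psi x := [forall A : {set K}, (#|A| <= l)%N ==> (x @: A \in F A)].

(* The condition psi read through the colours: when x is a section of c, the
   sets A of indices correspond to the subsets x @: A of the image of x. *)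
Let good c T := [forall B : {set V},
  [&& B \subset T, (#|B| <= l)%N & #|c @: B| == #|B|] ==> (B \in F (c @: B))].

(* An l-set is an edge if its colours lie in I and all its subsets with pairwise
   distinct colours satisfy the constraint that their colours impose.  The
   constraints bear on at most l vertices, so cliques see all of them. *)
Let G c I := [set A : {set V} | (c @: A \subset I) && [forall B : {set V},
  ((B \subset A) && (#|c @: B| == #|B|)) ==> (B \in F (c @: B))]].

Let clique_G c I T : T \in ksets V k ->
  clique l (G c I) T = (c @: T \subset I) && good c T.
Proof.
rewrite inE => /eqP cT; apply/cliqueP/andP => [H|[TI /forallP gT] A cA AT].
  split.
    apply/subsetP => _ /imsetP[v vT ->].
    have [] := @exists_between _ [set v] T l; rewrite ?sub1set ?cards1 ?cT //.
    move=> B [vB BT cB]; have := H B cB BT; rewrite inE => /andP[/subsetP + _].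
    by apply; rewrite imset_f // -sub1set.
  apply/forallP => B; apply/implyP => /and3P[BT Bl Bc].
  have [|A [BA AT cA]] := exists_between BT Bl; first by rewrite cT.
  have := H A cA AT; rewrite inE => /andP[_ /forallP/(_ B)/implyP]; apply.
  by rewrite BA.
rewrite inE (subset_trans (imsetS _ AT)) //=.
apply/forallP => B; apply/implyP => /andP[BA Bc]; apply: (implyP (gT B)).
by rewrite (subset_trans BA AT) Bc andbT /= -cA subset_leq_card.
Qed.

(* For k-sets, using all the k colours is the same as being transversal. *)
Let transversal_le c :
  `|\sum_(T in ksets V k) h T * ((c @: T == setT) && good c T)%:R| <= 2 ^+ k * d.
Proof.
have -> : \sum_(T in ksets V k) h T * ((c @: T == setT) && good c T)%:R =
    \sum_(I : {set K}) (-1) ^+ #|~: I| *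
      \sum_(T in ksets V k) h T * (clique l (G c I) T)%:R.
  under [RHS]eq_bigr do rewrite mulr_sumr.
  rewrite exchange_big /=; apply: eq_bigr => T Tk.
  rewrite -mulnb natrM full_set_sum mulr_suml mulr_sumr.
  by apply: eq_bigr => I _; rewrite clique_G // -mulnb natrM; ring.
apply: le_trans (ler_norm_sum _ _ _) _.
have -> : 2 ^+ k * d = \sum_(I : {set K}) d.
  by rewrite sumr_const -cardsT -powersetT card_powerset cardsT -[RHS]mulr_natl natrX.
apply: ler_sum => I _; rewrite normrM normrX normrN normr1 expr1n mul1r.
exact: h_disc.
Qed.

Let section c x := [forall j, c (x j) == j].

Let section_inj c x : section c x -> injectiveb x.
Proof.
move=> /forallP H; apply/injectiveP => i j e.
by rewrite -(eqP (H i)) -(eqP (H j)) e.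
Qed.

Let imset_section c x : section c x -> forall A : {set K}, c @: (x @: A) = A.
Proof.
move=> /forallP cx A; rewrite -imset_comp -[RHS]imset_id.
by apply: eq_imset => j; exact/eqP/cx.
Qed.

Let good_section c x : section c x -> good c (im x) = psi x.
Proof.
move=> cx; have /injectiveP ix := section_inj cx.
apply/forallP/forallP => H A; apply/implyP.
  move=> Al; have := implyP (H (x @: A)); rewrite (imset_section cx); apply.
  by rewrite imsetS ?subsetT // card_imset // Al eqxx.
case/and3P => AT Al _; have AE : A = x @: (x @^-1: A).
  apply/setP => v; apply/idP/imsetP => [vA|[j]]; last by rewrite inE => jA ->.
  have /imsetP[j _ e] := subsetP AT v vA; exists j => //; by rewrite inE -e.
rewrite [X in X \in _]AE {2}AE (imset_section cx); apply: (implyP (H _)).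
by rewrite -(card_imset _ ix) -AE.
Qed.

(* A transversal set of k vertices is the image of exactly one section. *)
Let sum_sections c :
  \sum_(T in ksets V k) h T * ((c @: T == setT) && good c T)%:R
    = \sum_(x | section c x) h (im x) * (psi x)%:R.
Proof.
pose tr := [set T in ksets V k | c @: T == setT].
have -> : \sum_(T in ksets V k) h T * ((c @: T == setT) && good c T)%:R =
    \sum_(T in tr) h T * (good c T)%:R.
  rewrite [RHS](eq_bigl (fun T => (T \in ksets V k) && (c @: T == setT))).
    rewrite [RHS]big_mkcondr /=; apply: eq_bigr => T _.
    by case: (c @: T == setT); rewrite /= ?mulr0.
  by move=> T; rewrite !inE.
have -> : tr = @im K V @: [set x | section c x].
  apply/setP => T; rewrite 2!inE; apply/andP/imsetP => [[/eqP cT /eqP TT]|].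
    have /fin_all_exists[x xP] j : exists v, v \in T /\ c v = j.
      by have /imsetP[v vT ->] : j \in c @: T; [rewrite TT inE|exists v].
    have cx : section c [ffun j => x j].
      by apply/forallP => j; rewrite ffunE; case: (xP j) => _ ->.
    exists [ffun j => x j]; first by rewrite inE.
    apply/eqP; rewrite eq_sym eqEcard (card_im (section_inj cx)) cT leqnn andbT.
    by apply/subsetP => _ /imsetP[j _ ->]; rewrite ffunE; case: (xP j).
  case=> x; rewrite inE => cx ->.
  by rewrite (card_im (section_inj cx)) (imset_section cx).
rewrite big_imset /=.
  apply: eq_big => [x|x]; rewrite inE // => cx; by rewrite good_section.
move=> x y; rewrite !inE => /forallP cx /forallP cy e; apply/ffunP => j.
have /imsetP[j' _ e'] : x j \in im y by rewrite -e imset_f ?inE.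
by rewrite e'; congr (y _); rewrite -(eqP (cy j')) -e' (eqP (cx j)).
Qed.

(* The colouring is prescribed on the k points of x and free elsewhere. *)
Let count_sections x : injectiveb x ->
  (\sum_(c : {ffun V -> K}) (section c x)%:R) * k%:R ^+ k = k%:R ^+ #|V| :> R.
Proof.
move=> /[dup] xi /injectiveP ix.
have -> : \sum_(c : {ffun V -> K}) (section c x)%:R =
    \sum_(c : {ffun V -> K}) \prod_v ((v \in im x) ==> (x (c v) == v))%:R :> R.
  apply: eq_bigr => c _; rewrite prod_bool; congr (nat_of_bool _)%:R.
  apply/forallP/forallP => [H v|H j]; last first.
    by rewrite -(inj_eq ix); apply: (implyP (H (x j))); rewrite imset_f ?inE.
  by apply/implyP => /imsetP[j _ ->]; rewrite (eqP (H j)).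
rewrite -(bigA_distr_bigA (fun v j => ((v \in im x) ==> (x j == v))%:R)) /=.
rewrite (eq_bigr (fun v => if v \in ~: im x then k%:R else 1 : R)) => [|v _].
  rewrite -big_mkcond prodr_const /= -[X in _ ^+ X * _](addnK #|im x|).
  have -> : (#|~: im x| + #|im x| = #|V|)%N by rewrite addnC cardsC.
  by rewrite (card_im xi) -exprD subnK // -(card_im xi) max_card.
rewrite inE; case: (boolP (v \in im x)) => /= [/imsetP[j _ ->]|_].
  rewrite (bigD1 j) //= eqxx big1 ?addr0 // => i /negPf ij.
  by rewrite (inj_eq ix) ij.
by rewrite sumr_const.
Qed.

(** Discrepancy against the cliques of all l-graphs controls the discrepancy
    against constraints attached separately to the sets of at most [l] indices of a
    tuple: such constraints become cliques after a colouring of the vertices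
    by [K], and all injective tuples are sections of the same number of
    colourings.  The constant counts the k^k of this average and the
    2^k terms of the inclusion-exclusion. *)
Lemma colouring_disc :
  `|\sum_(x : {ffun K -> V} | injectiveb x)
      h (im x) * [forall A : {set K}, (#|A| <= l)%N ==> (x @: A \in F A)]%:R|
    <= (2 * k)%:R ^+ k * d.
Proof.
set s := \sum_(x | _) _.
have k0 : (0 : R) < k%:R by rewrite ltr0n; apply: leq_trans l_le.
have sE : k%:R ^+ #|V| * s =
    k%:R ^+ k * \sum_(c : {ffun V -> K}) \sum_(T in ksets V k)
      h T * ((c @: T == setT) && good c T)%:R.
  under [in RHS]eq_bigr do rewrite sum_sections big_mkcond /=.
  rewrite exchange_big /= mulr_sumr /s mulr_sumr [LHS]big_mkcond /=.
  apply: eq_bigr => x _; rewrite -(big_mkcond (fun c => section c x)).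
  case: ifPn => [xi|xi].
    rewrite -(count_sections xi) mulrAC mulrC; congr (_ * _).
    rewrite mulr_suml [RHS]big_mkcond /=; apply: eq_bigr => c _.
    by case: (section c x); rewrite /= ?mul1r ?mul0r.
  rewrite big1 ?mulr0 // => c cx; by rewrite (section_inj cx) in xi.
rewrite -(ler_pM2l (exprn_gt0 #|V| k0)).
rewrite -{1}(ger0_norm (ltW (exprn_gt0 #|V| k0))) -normrM sE normrM.
rewrite ger0_norm ?exprn_ge0 ?(ltW k0) //.
have -> : k%:R ^+ #|V| * ((2 * k)%:R ^+ k * d) =
    k%:R ^+ k * \sum_(c : {ffun V -> K}) 2 ^+ k * d.
  by rewrite sumr_const card_ffun -(mulr_natl (_ * d)) natrX natrM exprMn; ring.
rewrite ler_pM2l ?exprn_gt0 //; apply: le_trans (ler_norm_sum _ _ _) _.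
by apply: ler_sum => c _; exact: transversal_le.
Qed.

End Colouring.

(** * A derandomised union bound *)

(** Method of conditional expectations.  If the bits of [E] were independent with
    means [w i], every factor would have mean 1 and the expectation of the left-hand
    side would be its right-hand side; so each bit can be chosen in turn without
    raising the conditional expectation. *)
Lemma choose_bits (R : realFieldType) (I J : finType) (w : I -> R)
    (b : J -> I -> R) (s : seq I) (c : J -> R) :
  uniq s -> (forall i, 0 <= w i <= 1) -> (forall j i, `|b j i| <= 1) ->
  (forall j, 0 <= c j) ->
  exists E : {set I}, (forall i, i \in E -> i \in s) /\
    \sum_j c j * \prod_(i <- s) (1 + ((i \in E)%:R - w i) * b j i)
      <= \sum_j c j.
Proof.
move=> us w01 b1; elim: s us c => [_ c c0|i s IH /= /andP[si us] c c0].
  exists set0; split=> [i|]; first by rewrite inE.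
  by under eq_bigr do rewrite big_nil mulr1.
have [w0 w1] := andP (w01 i).
have bi j : - 1 <= b j i <= 1 by rewrite -ler_norml.
pose c' (e : bool) j := c j * (1 + (e%:R - w i) * b j i).
have c'0 e j : 0 <= c' e j.
  rewrite mulr_ge0 //; have /andP[] := bi j; case: e => /=; nra.
have [e le_e] : exists e, \sum_j c' e j <= \sum_j c j.
  (* The two choices have average 1 with the weights w i and 1 - w i. *)
  have avg : w i * (\sum_j c' true j) + (1 - w i) * (\sum_j c' false j)
      = \sum_j c j.
    rewrite !mulr_sumr -big_split; apply: eq_bigr => j _; rewrite /c' /=; ring.
  have [|lt1] := lerP (\sum_j c' true j) (\sum_j c j); first by exists true.
  have [|lt0] := lerP (\sum_j c' false j) (\sum_j c j); first by exists false.
  have [w_gt0|w_le0] := ltrP 0 (w i); exfalso; nra.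
have [E [Es IHE]] := IH us (c' e) (c'0 e).
have iE : i \notin E by apply: contra si; apply: Es.
pose E' := if e then i |: E else E.
have E'i : (i \in E') = e.
  by rewrite /E'; case: e {le_e IHE E'}; rewrite ?setU11 // (negPf iE).
have E'other i' : i' \in s -> (i' \in E') = (i' \in E).
  move=> i's; rewrite /E'; case: e {le_e IHE E' E'i} => //.
  by rewrite !inE; case: eqP => // e; rewrite -e i's in si.
exists E'; split=> [i'|].
  rewrite inE; case: (eqVneq i' i) => //= ne; rewrite /E'.
  by case: e {le_e IHE E' E'i E'other}; rewrite ?inE ?(negPf ne) /=; apply: Es.
apply: le_trans le_e; apply: le_trans IHE; rewrite le_eqVlt; apply/orP; left.
apply/eqP; apply: eq_bigr => j _; rewrite big_cons E'i mulrA; congr (_ * _).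
by apply: eq_big_seq => i' i's; rewrite E'other.
Qed.

(** From [1 / (1 + y) = 1 - y / (1 + y) <= expR (- (y / (1 + y)))], and
    [y / (1 + y) >= y - 2 * y ^+ 2] on this range. *)
Lemma expR_le_one_plus (R : realType) (y : R) :
  `|y| <= 1 / 2 -> expR (y - 2 * y ^+ 2) <= 1 + y.
Proof.
rewrite ler_norml => /andP[y1 y2].
have y0 : 0 < 1 + y by lra.
apply: (@le_trans _ _ (expR (y / (1 + y)))).
  rewrite ler_expR ler_pdivlMr //; nra.
rewrite -[leRHS]invrK -[leLHS]invrK lef_pV2 ?posrE ?invr_gt0 ?expR_gt0 //.
rewrite -expRN; apply: le_trans (expR_ge1Dx _).
by rewrite [leLHS](_ : _ = 1 + - (y / (1 + y))) //; field; lra.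
Qed.

(** Exponential moments without independence: with [b = la * a], choose [E]
    so that the sum over the tests of the products of [1 + (E - w) * b] is at most its
    mean, the number of tests.  Each product is then at most that number, and it
    is at least the exponential of [la] times the discrepancy minus the
    quadratic error. *)
Lemma union_bound (R : realType) (I J : finType) (S : {set I}) (w : I -> R)
    (a : J -> I -> R) (la L : R) :
  (forall i, 0 <= w i <= 1) -> (forall j i, `|a j i| <= 1) ->
  0 <= la <= 1 / 2 -> (2 * #|J|)%:R <= expR L ->
  exists E : {set I}, E \subset S /\ forall j,
    la * `|\sum_(i in S) ((i \in E)%:R - w i) * a j i|
      <= 2 * la ^+ 2 * #|S|%:R + L.
Proof.
move=> w01 a1 /andP[la0 la2] JL.
(* The boolean is a sign: testing a and - a bounds the absolute value. *)
pose b (u : bool * J) i := (-1) ^+ u.1 * la * a u.2 i.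
have b_le u i : `|b u i| <= la.
  rewrite !normrM normrX normrN normr1 expr1n mul1r (ger0_norm la0).
  by rewrite -[leRHS]mulr1 ler_wpM2l.
have [|//|E [ES EJ]] := @choose_bits R I _ w b (enum S) (fun=> 1) (enum_uniq _) w01.
- by move=> u i; apply: le_trans (b_le u i) _; lra.
exists E; split=> [|j]; first by apply/subsetP => i /ES; rewrite mem_enum.
have term_ge0 u i : 0 <= 1 + ((i \in E)%:R - w i) * b u i.
  have := b_le u i; rewrite ler_norml => /andP[]; have := w01 i.
  by case: (i \in E); rewrite /=; nra.
have key (e : bool) :
    (-1) ^+ e * la * (\sum_(i in S) ((i \in E)%:R - w i) * a j i)
      <= 2 * la ^+ 2 * #|S|%:R + L.
  rewrite -lerBlDl -ler_expR; apply: le_trans JL.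
  have -> : (2 * #|J|)%:R = \sum_(u : bool * J) 1 :> R.
    by rewrite sumr_const card_prod card_bool.
  apply: le_trans EJ.
  rewrite (bigD1 (e, j)) //= mul1r -[leLHS]addr0; apply: lerD; last first.
    by apply: sumr_ge0 => u _; rewrite mul1r prodr_ge0.
  rewrite big_enum /=.
  apply: (@le_trans _ _ (\prod_(i in S) expR
    (((i \in E)%:R - w i) * b (e, j) i - 2 * la ^+ 2))).
    rewrite -expR_sum ler_expR sumrB sumr_const -(mulr_natr (2 * _)) mulr_sumr.
    rewrite lerD2r; apply: ler_sum => i _; rewrite /b /= le_eqVlt; apply/orP; left.
    by apply/eqP; ring.
  apply: ler_prod => i _; rewrite expR_ge0 /=.
  set y := _ * b _ _; have y_le : `|y| <= la.
    rewrite normrM -[leRHS]mul1r ler_pM // ler_norml; have := w01 i.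
    by case: (i \in E) => /=; lra.
  apply: le_trans (expR_le_one_plus _); last exact: le_trans la2.
  rewrite ler_expR lerD2l lerN2 ler_pM2l // -(real_normK (num_real y)).
  by rewrite lerXn2r ?nnegrE.
rewrite -{1}(ger0_norm la0) -normrM ler_norml lerNl.
by have := key true; have := key false; rewrite expr0 expr1 mul1r mulN1r mulNr => -> ->.
Qed.

Section Rate.
Context (R : realType).

Definition rate (n m : nat) : R := n%:R ^+ m / Num.sqrt n%:R.

Lemma rate_ge0 n m : 0 <= rate n m.
Proof. by rewrite /rate divr_ge0 ?exprn_ge0 ?sqrtr_ge0. Qed.

Lemma rateM n m m' : rate n m * n%:R ^+ m' = rate n (m + m').
Proof. by rewrite /rate exprD mulrAC. Qed.

(** Tests in number 2^O(n^(m-1)) can all be fooled: the union bound costs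
    O(n^(m-1)) / la against a main error la * n^m, and these balance, up to
    constants, at la = n^(-1/2). *)
Lemma exists_quasirandom (V J : finType) (m C : nat)
    (a : J -> {set V} -> R) (w : {set V} -> R) :
  (0 < m)%N -> (forall T, 0 <= w T <= 1) -> (forall j T, `|a j T| <= 1) ->
  (#|J| <= 2 ^ (C * #|V| ^ m.-1))%N ->
  exists E : {set {set V}}, E \subset ksets V m /\ forall j,
    `|\sum_(T in ksets V m) ((T \in E)%:R - w T) * a j T|
      <= (2 * C + 3)%:R * rate #|V| m.
Proof.
move=> m0 w01 a1 cJ; set n := #|V|.
have [n0|n0] := posnP n.
  exists set0; split=> [|j]; first exact: sub0set.
  rewrite big1 ?normr0; first by apply: mulr_ge0; rewrite ?rate_ge0.
  move=> T; rewrite inE => /eqP cT.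
  by have := max_card (mem T); rewrite cT -/n n0 leqNgt m0.
set q := Num.sqrt (n%:R : R).
have qq : q ^+ 2 = n%:R by rewrite sqr_sqrtr.
have q1 : 1 <= q by rewrite -sqrtr1 ler_sqrt // ler1n.
have q0 : 0 < q by lra.
have L2 : (2 * #|J|)%:R <= expR (1 + C%:R * n%:R ^+ m.-1 : R).
  apply: (@le_trans _ _ ((2 ^ (1 + C * n ^ m.-1))%:R : R)).
    by rewrite ler_nat expnD expn1 leq_mul2l cJ orbT.
  have -> : 1 + C%:R * n%:R ^+ m.-1 = (1 + C * n ^ m.-1)%:R * 1 :> R.
    by rewrite mulr1 natrD natrM natrX.
  rewrite expRM_natl natrX lerXn2r ?nnegrE ?expR_ge0 //.
  by apply: le_trans (expR_ge1Dx _).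
have la01 : 0 <= (2 * q)^-1 <= 1 / 2.
  rewrite invr_ge0 mulr_ge0 ?(ltW q0) //= div1r lef_pV2 ?posrE ?mulr_gt0 //.
  by rewrite ler_peMr.
have [E [ES EJ]] := union_bound (ksets V m) w01 a1 la01 L2.
exists E; split=> // j; move: (EJ j); set s := `|_| => le_s.
have {le_s} : s <= #|ksets V m|%:R / q + 2 * q * (1 + C%:R * n%:R ^+ m.-1).
  have -> : s = 2 * q * ((2 * q)^-1 * s) by field; lra.
  have -> : #|ksets V m|%:R / q + 2 * q * (1 + C%:R * n%:R ^+ m.-1) =
    2 * q * (2 * (2 * q)^-1 ^+ 2 * #|ksets V m|%:R + (1 + C%:R * n%:R ^+ m.-1)).
    by field; lra.
  by rewrite ler_pM2l // mulr_gt0.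
move/le_trans; apply.
have rE : rate n m = q * n%:R ^+ m.-1.
  rewrite /rate -/q -[in LHS](prednK m0) exprS -qq; field; lra.
have r1 : q <= rate n m.
  by rewrite rE ler_peMr ?(ltW q0) // exprn_ege1 // ler1n.
have k1 : #|ksets V m|%:R / q <= rate n m.
  by rewrite ler_pM2r ?invr_gt0 // -natrX ler_nat card_ksets_le.
rewrite natrD natrM; have := rE; nra.
Qed.

End Rate.

(** * Counting tuples of sets by ordered tuples *)

Lemma card_bool_sum (R : pzRingType) (T : finType) (P : pred T) :
  #|[set x | P x]|%:R = \sum_x (P x)%:R :> R.
Proof. by rewrite -sum1dep_card natr_sum big_mkcond; apply: eq_bigr => x _; case: (P x). Qed.

Lemma noninjective_le (R : realType) (K V : finType) : (0 < #|K|)%N ->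
  #|[set x : {ffun K -> V} | ~~ injectiveb x]|%:R
    <= (#|K| ^ 2)%:R * rate R #|V| #|K|.
Proof.
move=> K0; have [V0|V0] := posnP #|V|.
  have := max_card (mem [set x : {ffun K -> V} | ~~ injectiveb x]).
  rewrite card_ffun V0 exp0n // leqn0 => /eqP->.
  by rewrite mulr_ge0 ?rate_ge0.
have n0 : (0 : R) < #|V|%:R by rewrite ltr0n.
have q0 : 0 < Num.sqrt (#|V|%:R : R) by rewrite sqrtr_gt0.
rewrite /rate mulrA ler_pdivlMr // -natrX -natrM.
apply: (@le_trans _ _ ((#|V| * #|[set x : {ffun K -> V} | ~~ injectiveb x]|)%:R)).
  rewrite natrM mulrC ler_wpM2r // -{2}[#|V|%:R]sqr_sqrtr ?(ltW n0) // expr2.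
  by rewrite ler_peMr ?(ltW q0) // -[leLHS]sqrtr1 ler_sqrt // ler1n.
by rewrite ler_nat card_noninjective.
Qed.

Section ExpandTuples.
Context (R : realType) (K V : finType) (t : nat) (gamma : K -> 'I_t).
Implicit Types (x : {ffun K -> V}) (S : 'I_t -> {set {set V}}).

Definition blocks_in S x := [forall i, x @: block gamma i \in S i].

(** Conditions on disjoint tuples of sets can be counted on tuples of vertices:
    the fibres all have the size given by [card_tuples]. *)
Lemma card_block_tuples (P : pred {ffun 'I_t -> {set V}}) :
  (forall s, P s -> (forall i, #|s i| = #|block gamma i|) /\
     #|\bigcup_i s i| = #|K|) ->
  #|[set x : {ffun K -> V} | P [ffun i => x @: block gamma i]]|
    = (#|[set s | P s]| * #|block_symmetries gamma|)%N.
Proof.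
move=> HP; pose blocks x : {ffun 'I_t -> {set V}} := [ffun i => x @: block gamma i].
rewrite -sum_nat_const -[LHS]sum1dep_card (partition_big blocks P) //=.
apply: eq_big => [s|s Ps]; first by rewrite inE.
have [cs cU] := HP s Ps; rewrite -(card_tuples cs cU) sum1dep_card.
apply: eq_card => x; rewrite !inE; apply/andP/forallP => [[_ /eqP<- i]|H].
  by rewrite ffunE.
have bs : blocks x = s by apply/ffunP => i; rewrite ffunE; exact/eqP.
by rewrite -/(blocks x) bs Ps eqxx.
Qed.

(** The tuples of sets counted by [edge_tuples] are disjoint since their union has
    [k] elements, and so correspond to injective tuples of vertices; the
    product of the [#|S i|] also counts overlapping tuples of sets, which are
    at most as many as the non-injective tuples of vertices. *)
Lemma expand_tuples (k : nat) (p : R) (H : hypergraph k V) S :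
  (0 < k)%N -> #|K| = k -> 0 <= p <= 1 ->
  (forall i, S i \subset ksets V #|block gamma i|) ->
  `| #|block_symmetries gamma|%:R *
       (#|edge_tuples H S|%:R - p * \prod_i #|S i|%:R)
     - \sum_(x : {ffun K -> V} | injectiveb x)
          ((im x \in edges H)%:R - p) * (blocks_in S x)%:R |
    <= #|block_symmetries gamma|%:R * (k ^ 2)%:R * rate R #|V| k.
Proof.
move=> k0 cK /andP[p0 p1] Sk; set M := #|block_symmetries gamma|.
have cS s i : s i \in S i -> #|s i| = #|block gamma i|.
  by move=> /(subsetP (Sk i)); rewrite inE => /eqP.
pose inS (s : {ffun 'I_t -> {set V}}) := [forall i, s i \in S i].
pose disj (s : {ffun 'I_t -> {set V}}) := inS s && (#|\bigcup_i s i| == #|K|).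
pose crossing (s : {ffun 'I_t -> {set V}}) := inS s && (#|\bigcup_i s i| != #|K|).
have blocksE x : \bigcup_i [ffun i => x @: block gamma i] i = im x.
  by rewrite -(bigcup_block gamma x); apply: eq_bigr => i _; rewrite ffunE.
have inSE x : inS [ffun i => x @: block gamma i] = blocks_in S x.
  by apply: eq_forallb => i; rewrite ffunE.
have disjE x : (#|im x| == #|K|) = injectiveb x.
  by apply/eqP/idP => [/card_im_inj|/card_im].
have e1 : M%:R * #|edge_tuples H S|%:R =
    \sum_(x : {ffun K -> V} | injectiveb x)
      (im x \in edges H)%:R * (blocks_in S x)%:R :> R.
  rewrite -natrM mulnC -card_block_tuples => [|s /andP[/forallP sS sE]]; last first.
    split=> [i|]; first exact: cS.
    by have := subsetP (edges_uniform H) _ sE; rewrite inE cK => /eqP.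
  rewrite card_bool_sum [RHS]big_mkcond; apply: eq_bigr => x _.
  rewrite blocksE -/(inS _) inSE mulrC -natrM mulnb -disjE.
  case: (boolP (im x \in edges H)) => [|_]; last by rewrite !andbF; case: eqP.
  by move/(subsetP (edges_uniform H)); rewrite inE cK => ->.
have e2 : M%:R * #|[set s | disj s]|%:R =
    \sum_(x : {ffun K -> V} | injectiveb x) (blocks_in S x)%:R :> R.
  rewrite -natrM mulnC -card_block_tuples => [|s /andP[/forallP sS /eqP sE]]; last first.
    by split=> // i; exact: cS.
  rewrite card_bool_sum [RHS]big_mkcond; apply: eq_bigr => x _.
  by rewrite /disj blocksE inSE disjE; case: injectiveb; rewrite ?andbT ?andbF.
have e3 : \prod_i #|S i|%:R =
    #|[set s | disj s]|%:R + #|[set s | crossing s]|%:R :> R.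
  transitivity (\prod_i \sum_(B : {set V}) (B \in S i)%:R : R).
    apply: eq_bigr => i _; rewrite -card_bool_sum; congr (_%:R).
    by apply: eq_card => B; rewrite inE.
  rewrite bigA_distr_bigA !card_bool_sum -big_split; apply: eq_bigr => s _.
  rewrite prod_bool /disj /crossing -/(inS s).
  by case: (inS s); case: eqP; rewrite /= ?addr0 ?add0r.
have e4 : #|[set s | crossing s]|%:R <= (k ^ 2)%:R * rate R #|V| k.
  have := @noninjective_le R K V; rewrite cK => /(_ k0); apply: le_trans.
  rewrite ler_nat; set N := [set x : {ffun K -> V} | _].
  apply: leq_trans _ (leq_imset_card
    (fun x : {ffun K -> V} => [ffun i => x @: block gamma i]) N).
  apply: subset_leq_card; apply/subsetP => s; rewrite inE => /andP[/forallP sS ns].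
  have [x xs] := exists_tuple (fun i => cS s i (sS i)).
  have sE : s = [ffun i => x @: block gamma i].
    by apply/ffunP => i; rewrite ffunE xs.
  apply/imsetP; exists x => //; rewrite inE -disjE.
  by move: ns; rewrite sE blocksE.
rewrite mulrBr e1 (mulrCA _ p) e3 mulrDr e2.
set a := \sum_(x | _) (_ * _); set b := \sum_(x | _) (blocks_in S x)%:R.
have -> : \sum_(x : {ffun K -> V} | injectiveb x)
    ((im x \in edges H)%:R - p) * (blocks_in S x)%:R = a - p * b.
  by rewrite /a /b mulr_sumr -sumrB; apply: eq_bigr => x _; rewrite mulrBl.
have -> : a - p * (b + M%:R * #|[set s | crossing s]|%:R) - (a - p * b) =
   - (p * (M%:R * #|[set s | crossing s]|%:R)) by ring.
rewrite normrN !normrM !normr_nat (ger0_norm p0) -mulrA.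
rewrite -[leRHS]mul1r ler_pM ?mulr_ge0 //.
by rewrite ler_wpM2l.
Qed.

End ExpandTuples.

(** * Quasirandom graphs and bilinear forms *)

Section Bilinear.
Context (R : realFieldType) (V : finType).

(** The extreme case is the sign of [rho], whose positive and negative parts are
    indicators. *)
Lemma cut_signed (rho phi : V -> R) (d : R) :
  (forall U : {set V}, `|\sum_(v in U) rho v| <= d) ->
  (forall v, `|phi v| <= 1) ->
  `|\sum_v phi v * rho v| <= 2 * d.
Proof.
move=> rho_d phi1; apply: le_trans (ler_norm_sum _ _ _) _.
apply: (@le_trans _ _ (\sum_v `|rho v|)).
  by apply: ler_sum => v _; rewrite normrM -[leRHS]mul1r ler_wpM2r.
pose U := [set v | 0 <= rho v].
have -> : \sum_v `|rho v| = \sum_(v in U) rho v - \sum_(v in ~: U) rho v.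
  rewrite (bigID (mem U)) /= -sumrN; congr (_ + _).
    by apply: eq_bigr => v; rewrite inE => /ger0_norm.
  apply: eq_big => [v|v]; first by rewrite !inE.
  by rewrite inE -ltNge => /ltr0_norm.
have := rho_d U; have := rho_d (~: U); rewrite !ler_norml.
by move=> /andP[? ?] /andP[? ?]; lra.
Qed.

Lemma cut_bilinear (g : V -> V -> R) (phi chi : V -> R) (d : R) :
  (forall U W : {set V}, `|\sum_(v in U) \sum_(v' in W) g v v'| <= d) ->
  (forall v, `|phi v| <= 1) -> (forall v, `|chi v| <= 1) ->
  `|\sum_v \sum_v' g v v' * (phi v * chi v')| <= 4 * d.
Proof.
move=> g_d phi1 chi1.
have -> : \sum_v \sum_v' g v v' * (phi v * chi v') =
    \sum_v phi v * \sum_v' chi v' * g v v'.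
  apply: eq_bigr => v _; rewrite mulr_sumr; apply: eq_bigr => v' _; ring.
have -> : 4 * d = 2 * (2 * d) by ring.
apply: cut_signed => // U; rewrite exchange_big /=.
under eq_bigr do rewrite -mulr_sumr.
by apply: cut_signed => // W; rewrite exchange_big.
Qed.

(** For a fixed value of all coordinates but [a] and [b], the sum is a bilinear form
    of the matrix [g [set v; v']].  Fixing coordinates is expressed by
    resampling [a] and [b], whence the powers of [#|V|]. *)
Lemma bilinear_tuples (K : finType) (a b : K) (g : {set V} -> R) (d : R)
    (alpha beta : {ffun K -> V} -> R) :
  a != b ->
  (forall U W : {set V}, `|\sum_(v in U) \sum_(v' in W) g [set v; v']| <= d) ->
  (forall x, `|alpha x| <= 1) -> (forall x, `|beta x| <= 1) ->
  (forall x v, alpha (upd x b v) = alpha x) ->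
  (forall x v, beta (upd x a v) = beta x) ->
  `|\sum_(x : {ffun K -> V}) g (x @: [set a; b]) * (alpha x * beta x)|
      * #|V|%:R ^+ 2 <= 4 * d * #|V|%:R ^+ #|K|.
Proof.
move=> ab g_d alpha1 beta1 alphaE betaE.
set f := fun x : {ffun K -> V} => g (x @: [set a; b]) * (alpha x * beta x).
have n0 : 0 <= #|V|%:R ^+ 2 :> R by rewrite exprn_ge0.
rewrite -{1}(ger0_norm n0) -normrM.
have -> : (\sum_x f x) * #|V|%:R ^+ 2 =
    \sum_x \sum_v \sum_v' f (upd (upd x a v) b v').
  have := sum_upd f b; rewrite -[X in _ = X]mulr_natr expr2 mulrA => <-.
  rewrite mulr_natr -(sum_upd (fun x => \sum_v f (upd x b v)) a).
  by apply: eq_bigr => x _; apply: eq_bigr.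
apply: le_trans (ler_norm_sum _ _ _) _.
have -> : 4 * d * #|V|%:R ^+ #|K| = \sum_(x : {ffun K -> V}) 4 * d.
  by rewrite sumr_const card_ffun -(mulr_natr (4 * d)) natrX.
apply: ler_sum => x _.
have -> : \sum_v \sum_v' f (upd (upd x a v) b v') =
  \sum_v \sum_v' g [set v; v'] * (alpha (upd x a v) * beta (upd x b v')).
  apply: eq_bigr => v _; apply: eq_bigr => v' _.
  rewrite /f alphaE {2}updC // betaE imsetU !imset_set1 upd_same.
  by rewrite upd_other // upd_same.
by apply: cut_bilinear.
Qed.

End Bilinear.

Section SignGraph.
Context (R : realType).

(** The value 0 outside pairs makes products of signs over all pairs of
    indices vanish on non-injective tuples. *)
Definition pair_sign (V : finType) (D : {set {set V}}) (B : {set V}) : R :=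
  if #|B| == 2 then (if B \in D then 1 else -1) else 0.

Lemma pair_sign_le1 (V : finType) (D : {set {set V}}) B : `|pair_sign D B| <= 1.
Proof.
by rewrite /pair_sign; case: ifP => _; first case: ifP => _;
   rewrite ?normrN ?normr1 ?normr0.
Qed.

(** The tests are the pairs [(U, W)], of which there are 2^(2n), so the union bound
    applies with m = 2. *)
Lemma exists_sign_graph (V : finType) : exists D : {set {set V}},
  forall U W : {set V},
    `|\sum_(v in U) \sum_(v' in W) pair_sign D [set v; v']| <= 56 * rate R #|V| 2.
Proof.
(* A pair is the set of at most 4 ordered pairs of its elements. *)
pose a (J : {set V} * {set V}) (B : {set V}) : R :=
  (\sum_(v in J.1) \sum_(v' in J.2) ([set v; v'] == B)%:R) / 4.
have a1 J B : `|a J B| <= 1.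
  rewrite ger0_norm; last first.
    by rewrite divr_ge0 // sumr_ge0 // => v _; rewrite sumr_ge0.
  rewrite ler_pdivrMr // mul1r.
  have [[v0 v0'] /= /eqP B0|noB] :=
      pickP [pred u : V * V | [set u.1; u.2] == B]; last first.
    rewrite big1 // => v _; rewrite big1 // => v' _.
    by have := noB (v, v'); rewrite /= => ->.
  apply: (@le_trans _ _ (\sum_(v in B) \sum_(v' in B) 1)).
    rewrite big_mkcond [leRHS]big_mkcond; apply: ler_sum => v _.
    case: (boolP (v \in B)) => [vB|vB]; last first.
      case: ifP => // _; rewrite big1 // => v' _; case: eqP => // e.
      by rewrite -e !inE eqxx in vB.
    rewrite big_mkcond [X in _ <= X]big_mkcond /=.
    case: ifP => _; last by apply: sumr_ge0 => v' _; case: ifP.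
    apply: ler_sum => v' _; case: (boolP (v' \in B)) => [v'B|v'B].
      by case: ifP => // _; case: eqP.
    case: ifP => // _; case: eqP => // e.
    by rewrite -e !inE eqxx orbT in v'B.
  rewrite !sumr_const -mulrnA -B0 ler_nat.
  have : (#|[set v0; v0']| <= 2)%N by rewrite cards2; case: eqP.
  by case: #|_| => [|[|[|]]].
have cJ : (#|{: {set V} * {set V}}| <= 2 ^ (2 * #|V| ^ 2.-1))%N.
  by rewrite card_prod -cardsT -powersetT card_powerset cardsT -expnD mul2n addnn expn1.
have w01 (T : {set V}) : 0 <= (1 / 2 : R) <= 1 by lra.
have [D [_ HD]] := exists_quasirandom (isT : (0 < 2)%N) w01 a1 cJ.
exists D => U W; move: (HD (U, W)) => {w01 HD}.
have -> : \sum_(T in ksets V 2) ((T \in D)%:R - 1 / 2) * a (U, W) T =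
    (\sum_(v in U) \sum_(v' in W) pair_sign D [set v; v']) / 8.
  rewrite mulr_suml /a /=.
  transitivity (\sum_(T in ksets V 2) \sum_(v in U) \sum_(v' in W)
    ([set v; v'] == T)%:R * (pair_sign D [set v; v'] / 8)).
    apply: eq_bigr => T; rewrite inE => T2.
    rewrite !mulr_suml mulr_sumr; apply: eq_bigr => v _.
    rewrite !mulr_suml mulr_sumr; apply: eq_bigr => v' _.
    case: (eqVneq [set v; v'] T) => [->|_]; last by rewrite !mul0r mulr0.
    by rewrite /pair_sign T2; case: (T \in D) => /=; field.
  rewrite exchange_big; apply: eq_bigr => v _ /=.
  rewrite exchange_big mulr_suml; apply: eq_bigr => v' _ /=.
  rewrite -mulr_suml; case: (boolP ([set v; v'] \in ksets V 2)) => v2.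
    rewrite (bigD1 [set v; v']) //= eqxx big1 ?addr0 ?mul1r // => T /andP[_].
    by rewrite eq_sym => /negPf->.
  by rewrite /pair_sign; rewrite inE in v2; rewrite (negPf v2) mul0r mulr0.
rewrite normrM (@ger0_norm _ 8^-1) ?invr_ge0 // ler_pdivrMr //.
move/le_trans; apply; have := rate_ge0 R #|V| 2; rewrite natrD natrM; lra.
Qed.

Lemma exists_bilinear_graph (V : finType) : exists D : {set {set V}},
  forall (K : finType) (a b : K) (alpha beta : {ffun K -> V} -> R),
    a != b ->
    (forall x, `|alpha x| <= 1) -> (forall x, `|beta x| <= 1) ->
    (forall x v, alpha (upd x b v) = alpha x) ->
    (forall x v, beta (upd x a v) = beta x) ->
    `|\sum_(x : {ffun K -> V})
        pair_sign D (x @: [set a; b]) * (alpha x * beta x)|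
      <= 224 * rate R #|V| #|K|.
Proof.
have [D HD] := exists_sign_graph V; exists D => K a b alpha beta ab alpha1 beta1 alphaE betaE.
have := bilinear_tuples ab HD alpha1 beta1 alphaE betaE; set s := `|_|.
have [V0 _|V0] := posnP #|V|.
  rewrite /s big1 ?normr0; first by apply: mulr_ge0; rewrite ?rate_ge0.
  move=> x _; by have := max_card (mem [set x a]); rewrite cards1 V0.
have n0 : (0 : R) < #|V|%:R ^+ 2 by rewrite exprn_gt0 // ltr0n.
have rE : rate R #|V| 2 * #|V|%:R ^+ #|K| = rate R #|V| #|K| * #|V|%:R ^+ 2.
  by rewrite !rateM addnC.
have -> : 4 * (56 * rate R #|V| 2) * #|V|%:R ^+ #|K| =
    224 * rate R #|V| #|K| * #|V|%:R ^+ 2.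
  by rewrite -[RHS]mulrA -rE; ring.
by rewrite ler_pM2r.
Qed.

End SignGraph.

(** * Error terms and sequences *)

Section LittleO.
Context (R : realType) (k : nat).
Implicit Types (f : nat -> R).

Lemma little_oP f : is_little_o_pow k f <->
  forall e, 0 < e -> exists N, forall n, (N <= n)%N -> `|f n| <= e * n%:R ^+ k.
Proof.
have absE n : (0 < n)%N -> `|0 - f n / n%:R ^+ k| = `|f n| / n%:R ^+ k.
  by move=> n0; rewrite sub0r normrN normrM normfV normrX normr_nat.
have pos n : (0 < n)%N -> (0 : R) < n%:R ^+ k.
  by move=> n0; rewrite exprn_gt0 // ltr0n.
split=> [/cvgrPdist_le lo e e0|lo].
  have [N _ HN] := lo e e0; exists N.+1 => n Nn.
  have n0 : (0 < n)%N by apply: leq_ltn_trans Nn.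
  by have := HN n (ltnW Nn); rewrite /= absE // ler_pdivrMr // pos.
apply/cvgrPdist_le => e e0; have [N HN] := lo e e0.
exists N.+1 => // n /= Nn.
have n0 : (0 < n)%N by apply: leq_ltn_trans Nn.
by rewrite absE // ler_pdivrMr ?pos // HN // ltnW.
Qed.

Lemma rate_little_o : is_little_o_pow k (fun n => rate R n k).
Proof.
apply/little_oP => e e0; have [N HN] : exists N : nat, e ^- 2 <= N%:R.
  exists (Num.bound (e ^- 2)); apply/ltW/archi_boundP.
  by rewrite invr_ge0 exprn_ge0 // ltW.
exists N.+1 => n Nn; rewrite ger0_norm ?rate_ge0 // /rate mulrC.
rewrite ler_wpM2r ?exprn_ge0 // -[leRHS]invrK lef_pV2 ?posrE ?invr_gt0 //; last first.
  by rewrite sqrtr_gt0 ltr0n; apply: leq_ltn_trans Nn.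
rewrite -(@ler_pXn2r _ 2) ?nnegrE ?sqrtr_ge0 ?invr_ge0 ?(ltW e0) //.
rewrite sqr_sqrtr // exprVn; apply: le_trans HN _.
by rewrite ler_nat ltnW.
Qed.

Lemma little_o_comb f g (a b : R) :
  is_little_o_pow k f -> is_little_o_pow k g ->
  is_little_o_pow k (fun n => a * f n + b * g n).
Proof.
move=> /little_oP Hf /little_oP Hg; apply/little_oP => e e0.
have pa (c : R) : 0 < e / (2 * (`|c| + 1)) by rewrite divr_gt0 // mulr_gt0 // ltr_pwDr.
have half (c : R) : `|c| * (e / (2 * (`|c| + 1))) <= e / 2.
  have c0 := normr_ge0 c.
  rewrite mulrA ler_pdivrMr ?mulr_gt0 ?ltr_pwDr //; nra.
have [N HN] := Hf _ (pa a); have [N' HN'] := Hg _ (pa b).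
exists (maxn N N') => n; rewrite geq_max => /andP[/HN Nn /HN' Nn'].
apply: le_trans (ler_normD _ _) _; rewrite !normrM.
have n0 : 0 <= n%:R ^+ k :> R by rewrite exprn_ge0.
have -> : e * n%:R ^+ k = e / 2 * n%:R ^+ k + e / 2 * n%:R ^+ k by field.
apply: lerD.
  apply: le_trans (ler_wpM2l (normr_ge0 a) Nn) _.
  by rewrite mulrA ler_wpM2r.
apply: le_trans (ler_wpM2l (normr_ge0 b) Nn') _.
by rewrite mulrA ler_wpM2r.
Qed.

Lemma little_o_lt f (c : R) (N : nat) : is_little_o_pow k f -> 0 < c ->
  ~ forall n, (N <= n)%N -> c * n%:R ^+ k <= f n.
Proof.
move=> /little_oP Hf c0 H; have c2 : 0 < c / 2 by lra.
have [N' HN'] := Hf _ c2; pose n := (maxn N N').+1.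
have Nn : (N <= n)%N by rewrite leqW // leq_maxl.
have Nn' : (N' <= n)%N by rewrite leqW // leq_maxr.
have := H n Nn; have := HN' n Nn'; have := ler_norm (f n).
have : (0 : R) < n%:R ^+ k by rewrite exprn_gt0 // ltr0n.
nra.
Qed.

End LittleO.

Lemma make_seq (k : nat) (P : forall V : finType, hypergraph k V -> Prop) :
  (forall V, exists H : hypergraph k V, P V H) ->
  exists Hs : hypergraph_seq k, forall n, P (vertices Hs n) (graph Hs n).
Proof.
move=> HP.
exists (@HypergraphSeq k (fun n => 'I_n) card_ord (fun n => sval (cid (HP 'I_n)))).
by move=> n /=; case: cid.
Qed.

(** * Clique discrepancy *)

Section Cliques.
Context (R : realType).

(** For [l <= m], the cliques of an l-graph are cliques of the m-graph of its
    m-cliques; so tests by m-graphs include the tests by l-graphs. *)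
Lemma clique_lift (V : finType) (l m : nat) (G : {set {set V}}) (T : {set V}) :
  (l <= m)%N -> (m <= #|T|)%N ->
  clique m [set A | clique l G A] T = clique l G T.
Proof.
move=> lm mT; apply/cliqueP/cliqueP => [H A cA AT|H A cA AT].
  have [|B [AB BT cB]] := exists_between AT _ mT; first by rewrite cA.
  by have := H B cB BT; rewrite inE => /cliqueP; apply.
by rewrite inE; apply/cliqueP => B cB BA; apply: H => //; apply: subset_trans AT.
Qed.

Lemma clique_trim (V : finType) (l : nat) (G : {set {set V}}) (T : {set V}) :
  clique l (G :&: ksets V l) T = clique l G T.
Proof.
by apply/cliqueP/cliqueP => H A cA AT; have := H A cA AT; rewrite !inE cA eqxx andbT.
Qed.

Lemma cliques_sum (V : finType) (k l : nat) (p : R)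
    (H : hypergraph k V) (G : hypergraph l V) :
  #|edges H :&: cliques k G|%:R - p * #|cliques k G|%:R =
  \sum_(T in ksets V k) ((T \in edges H)%:R - p) * (clique l (edges G) T)%:R.
Proof.
have cE T : (T \in cliques k G) = (T \in ksets V k) && clique l (edges G) T.
  by rewrite inE.
have -> : #|cliques k G|%:R =
    \sum_(T in ksets V k) (clique l (edges G) T)%:R :> R.
  rewrite -sum1_card natr_sum; under eq_bigl do rewrite cE.
  by rewrite big_mkcondr; apply: eq_bigr => T _; case: clique.
have -> : #|edges H :&: cliques k G|%:R = \sum_(T in ksets V k)
    (T \in edges H)%:R * (clique l (edges G) T)%:R :> R.
  rewrite -sum1_card natr_sum.
  under eq_bigl do rewrite inE cE andbCA.
  rewrite big_mkcondr; apply: eq_bigr => T _.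
  by rewrite -natrM mulnb; case: (_ && _).
by rewrite mulr_sumr -sumrB; apply: eq_bigr => T _; rewrite mulrBl.
Qed.

Lemma clique_disc_le (k l : nat) (p : R) (Hs : hypergraph_seq k) (n : nat) (d : R) :
  (forall G : hypergraph l (vertices Hs n),
    `| #|edges (graph Hs n) :&: cliques k G|%:R
         - p * #|cliques k G|%:R | <= d) <->
  (forall G : {set {set vertices Hs n}},
    `|\sum_(T in ksets (vertices Hs n) k)
        ((T \in edges (graph Hs n))%:R - p) * (clique l G T)%:R| <= d).
Proof.
split=> [H G|H G]; last by rewrite cliques_sum.
have := H (Hypergraph (subsetIr G (ksets _ l))); rewrite cliques_sum /=.
by under eq_bigr do rewrite clique_trim.
Qed.

(** A hypergraph with prescribed density [w] that fools the cliques of all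
    (m-1)-graphs, hence those of all l-graphs with [l < m]. *)
Lemma exists_disc (V : finType) (m : nat) (w : {set V} -> R) :
  (0 < m)%N -> (forall T, 0 <= w T <= 1) ->
  exists E : {set {set V}}, E \subset ksets V m /\
    forall (l : nat) (G : {set {set V}}), (l < m)%N ->
      `|\sum_(T in ksets V m) ((T \in E)%:R - w T) * (clique l G T)%:R|
        <= 5 * rate R #|V| m.
Proof.
move=> m0 w01.
pose J := {G : {set {set V}} | G \in powerset (ksets V m.-1)}.
have cJ : (#|{: J}| <= 2 ^ (1 * #|V| ^ m.-1))%N.
  by rewrite card_sig card_powerset leq_pexp2l // mul1n card_ksets_le.
have [] := @exists_quasirandom R V J m 1
  (fun (G : J) T => (clique m.-1 (val G) T)%:R) w m0 w01 _ cJ.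
  by move=> G T; rewrite normr_nat; case: clique.
move=> E [EV HE]; exists E; split=> // l G lm.
have trimG : [set A | clique l G A] :&: ksets V m.-1 \in powerset (ksets V m.-1).
  by rewrite inE subsetIr.
have := HE (exist (fun G => G \in powerset (ksets V m.-1)) _ trimG).
have -> : (2 * 1 + 3)%:R = 5 :> R by [].
congr (`|_| <= _); apply: eq_bigr => T; rewrite inE => /eqP cT /=.
by rewrite clique_trim clique_lift // ?cT ?leq_pred // -ltnS prednK.
Qed.

(** The test of [Expand] attaches a constraint to each block only, so it is an
    instance of [colouring_disc] as soon as the blocks have at most [l] elements. *)
Lemma blocks_disc (V : finType) (k l t : nat) (gamma : 'I_k -> 'I_t)
    (h : {set V} -> R) (d : R) (S : 'I_t -> {set {set V}}) :
  (0 < l)%N -> (l <= k)%N -> (forall i, #|block gamma i| <= l)%N ->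
  (forall G : {set {set V}},
    `|\sum_(T in ksets V k) h T * (clique l G T)%:R| <= d) ->
  `|\sum_(x : {ffun 'I_k -> V} | injectiveb x)
      h (im x) * (blocks_in gamma S x)%:R| <= (2 * k)%:R ^+ k * d.
Proof.
move=> l0 lk gl h_disc.
pose F (A : {set 'I_k}) :=
  [set B : {set V} | [forall i, (A == block gamma i) ==> (B \in S i)]].
have := @colouring_disc R 'I_k V l h d F l0; rewrite !card_ord => /(_ lk h_disc).
congr (`|_| <= _); apply: eq_bigr => x _; congr (_ * (nat_of_bool _)%:R).
apply/forallP/forallP => [H i|H A].
  have := implyP (H (block gamma i)) (gl i); rewrite inE => /forallP/(_ i).
  by rewrite eqxx.
apply/implyP => _; rewrite inE; apply/forallP => i; apply/implyP => /eqP->.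
exact: H.
Qed.

End Cliques.

(** * The implications *)

Section Implications.
Context (R : realType) (k : nat) (p : R) (pi : seq nat).
Context (gamma : 'I_k -> 'I_(size pi)).
Hypothesis k_gt0 : (0 < k)%N.
Hypothesis p01 : 0 <= p <= 1.
Hypothesis gammaE : forall i, #|block gamma i| = nth 0%N pi i.

Let M := #|block_symmetries gamma|.
Let M_gt0 : (0 : R) < M%:R. Proof. by rewrite ltr0n block_symmetries_gt0. Qed.

Lemma expand_tuplesP (V : finType) (H : hypergraph k V)
    (S : 'I_(size pi) -> {set {set V}}) :
  (forall i, S i \subset ksets V (nth 0%N pi i)) ->
  `| M%:R * (#|edge_tuples H S|%:R - p * \prod_(i < size pi) #|S i|%:R)
     - \sum_(x : {ffun 'I_k -> V} | injectiveb x)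
          ((im x \in edges H)%:R - p) * (blocks_in gamma S x)%:R |
    <= M%:R * (k ^ 2)%:R * rate R #|V| k.
Proof.
move=> Sk; apply: expand_tuples => //; first exact: card_ord.
by move=> i; rewrite gammaE.
Qed.

Lemma expand_of_tuples (V : finType) (H : hypergraph k V)
    (S : 'I_(size pi) -> {set {set V}}) (d : R) :
  (forall i, S i \subset ksets V (nth 0%N pi i)) ->
  `|\sum_(x : {ffun 'I_k -> V} | injectiveb x)
       ((im x \in edges H)%:R - p) * (blocks_in gamma S x)%:R| <= d ->
  `| #|edge_tuples H S|%:R - p * \prod_(i < size pi) #|S i|%:R |
    <= (k ^ 2)%:R * rate R #|V| k + M%:R^-1 * d.
Proof.
move=> /(expand_tuplesP H); set s := \sum_(x | _) _.
set e := #|_|%:R - p * _ => eP sd.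
rewrite -(ler_pM2l M_gt0) -{1}(ger0_norm (ltW M_gt0)) -normrM.
rewrite [leRHS](_ : _ = M%:R * (k ^ 2)%:R * rate R #|V| k + d); last first.
  by rewrite mulrDr [X in _ + X]mulrA divff ?gt_eqF // mul1r mulrA.
rewrite -[M%:R * e](subrK s); apply: le_trans (ler_normD _ _) _.
exact: lerD.
Qed.

(** The deviation of the edge set from density [p] is the weight of
    [blocks_disc]. *)
Lemma clique_disc_expand (l : nat) (Hs : hypergraph_seq k) :
  (0 < l)%N -> (l <= k)%N -> (forall ki, ki \in pi -> (ki <= l)%N) ->
  CliqueDisc p l Hs -> Expand p pi Hs.
Proof.
move=> l0 lk pil [f f0 Hf].
exists (fun n => (k ^ 2)%:R * rate R n k + M%:R^-1 * (2 * k)%:R ^+ k * f n).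
  by apply: little_o_comb => //; exact: rate_little_o.
move=> n S Sk; rewrite -mulrA -[in rate _ n _](card_vertices Hs n).
apply: expand_of_tuples => //.
apply: (blocks_disc S (h := fun T => (T \in edges (graph Hs n))%:R - p) l0 lk).
  by move=> i; rewrite gammaE; apply: pil; rewrite mem_nth.
by apply/clique_disc_le => G; exact: Hf.
Qed.

(** A 1-graph is a set [U] of vertices and its cliques are the k-subsets of [U].  An
    injective tuple has its image in [U] if and only if all its blocks do, so
    the sets [S i] of all k_i-subsets of [U] give this test, each k-set being
    counted [k`!] times. *)
Lemma expand_clique_disc1 (Hs : hypergraph_seq k) :
  Expand p pi Hs -> CliqueDisc p 1 Hs.
Proof.
move=> [f f0 Hf]; pose c : R := (k`!)%:R.
have c0 : 0 < c by rewrite ltr0n fact_gt0.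
exists (fun n => c^-1 * M%:R * f n + c^-1 * (M%:R * (k ^ 2)%:R) * rate R n k).
  by apply: little_o_comb => //; exact: rate_little_o.
move=> n; apply/clique_disc_le => G.
set V := vertices Hs n; set H := graph Hs n.
pose U := [set v : V | [set v] \in G].
have cU (T : {set V}) : clique 1 G T = (T \subset U).
  apply/cliqueP/subsetP => [TG v vT|TU A /eqP/cards1P[v ->]].
    by rewrite inE; apply: TG; rewrite ?cards1 ?sub1set.
  by rewrite sub1set => /TU; rewrite inE.
pose S (i : 'I_(size pi)) := [set B in ksets V (nth 0%N pi i) | B \subset U].
have Sk i : S i \subset ksets V (nth 0%N pi i).
  by apply/subsetP => B; rewrite inE => /andP[].
have := expand_tuplesP H Sk.
have -> : \sum_(x : {ffun 'I_k -> V} | injectiveb x)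
    ((im x \in edges H)%:R - p) * (blocks_in gamma S x)%:R =
    c * \sum_(T in ksets V k) ((T \in edges H)%:R - p) * (clique 1 G T)%:R.
  have := @sum_injective_im R 'I_k V
    (fun T => ((T \in edges H)%:R - p) * (clique 1 G T)%:R).
  rewrite card_ord => <-; apply: eq_bigr => x xi; congr (_ * (nat_of_bool _)%:R).
  rewrite cU; apply/forallP/subsetP => [xS v|xU i].
    case/imsetP => j _ ->; have := xS (gamma j); rewrite inE => /andP[_ /subsetP].
    by apply; apply: imset_f; rewrite inE.
  rewrite 2!inE card_imset ?gammaE ?eqxx; last exact/injectiveP.
  by apply/subsetP => _ /imsetP[j _ ->]; apply: xU; rewrite imset_f ?inE.
set s := \sum_(T in _) _; set e := #|_|%:R - p * _ => eP.
have {}eP : `|c * s| <= M%:R * f n + M%:R * (k ^ 2)%:R * rate R n k.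
  have -> : c * s = M%:R * e - (M%:R * e - c * s) by ring.
  apply: le_trans (ler_normB _ _) _; apply: lerD.
    by rewrite normrM (ger0_norm (ltW M_gt0)) ler_pM2l //; exact: Hf.
  by rewrite -[in rate _ n _](card_vertices Hs n).
rewrite -!mulrA -mulrDr -(ler_pM2l c0) mulVKf ?gt_eqF //.
by rewrite -{1}(ger0_norm (ltW c0)) -normrM mulrA.
Qed.

End Implications.

(** * Expansion does not control cliques of pairs *)

Section PairProduct.
Context (R : realType).

Definition pair_product (V : finType) (D : {set {set V}}) (T : {set V}) : R :=
  \prod_(B in [set B in ksets V 2 | B \subset T]) pair_sign R D B.

Lemma pair_product_im (K V : finType) (D : {set {set V}}) (x : {ffun K -> V}) :
  injectiveb x ->
  pair_product D (im x) = \prod_(A in ksets K 2) pair_sign R D (x @: A).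
Proof.
move=> /injectiveP ix; rewrite /pair_product.
rewrite -(big_imset (h := fun A : {set K} => x @: A)) /=; last first.
  by move=> A B _ _; apply: imset_inj.
apply: eq_bigl => B; rewrite inE; apply/andP/imsetP => [[]|[A]].
  rewrite inE => B2 /subsetP Bx.
  have BE : B = x @: (x @^-1: B).
    apply/setP => v; apply/idP/imsetP => [vB|[j]]; last by rewrite inE => jB ->.
    by have /imsetP[j _ e] := Bx v vB; exists j => //; rewrite inE -e.
  exists (x @^-1: B) => //; by rewrite inE -(card_imset _ ix) -BE.
rewrite inE => A2 ->; rewrite inE card_imset // A2; split=> //.
by apply: imsetS; apply: subsetT.
Qed.

Lemma pair_signs_noninjective (K V : finType) (D : {set {set V}})
    (x : {ffun K -> V}) : ~~ injectiveb x ->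
  \prod_(A in ksets K 2) pair_sign R D (x @: A) = 0.
Proof.
move=> /injectivePn[a [b ab e]].
rewrite (bigD1 [set a; b]) /=; last by rewrite inE cards2 ab.
by rewrite imsetU !imset_set1 -e setUid /pair_sign cards1 mul0r.
Qed.

Lemma prod_le1 (I : finType) (P : pred I) (f : I -> R) :
  (forall i, `|f i| <= 1) -> `|\prod_(i | P i) f i| <= 1.
Proof.
move=> f1; elim/big_ind: _ => [|a b a1 b1|//]; first by rewrite normr1.
by rewrite normrM -[leRHS]mulr1 ler_pM.
Qed.

Lemma pair_product_le1 (V : finType) (D : {set {set V}}) T :
  `|pair_product D T| <= 1.
Proof. by apply: prod_le1 => B; exact: pair_sign_le1. Qed.

(** Choose indices [a] and [b] in two different blocks.  Apart from the sign of the pair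
    of their values, each factor of the test involves at most one of the
    two: no other pair of indices contains both, and no block does. *)
Lemma pair_product_blocks (V : finType) : exists D : {set {set V}},
  forall (k t : nat) (gamma : 'I_k -> 'I_t) (S : 'I_t -> {set {set V}}),
    (1 < t)%N -> (forall i, 0 < #|block gamma i|)%N ->
    `|\sum_(x : {ffun 'I_k -> V} | injectiveb x)
        pair_product D (im x) * (blocks_in gamma S x)%:R|
      <= 224 * rate R #|V| k.
Proof.
have [D HD] := exists_bilinear_graph R V; exists D => k t gamma S t1 g0.
have /card_gt0P[a] := g0 (Ordinal (ltnW t1)).
have /card_gt0P[b] := g0 (Ordinal t1).
rewrite !inE => /eqP gb /eqP ga.
have gab : gamma a != gamma b by rewrite ga gb.
have ab : a != b by apply: contraNneq gab => ->.
pose A0 := [set a; b].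
pose q (A : {set 'I_k}) (x : {ffun 'I_k -> V}) := pair_sign R D (x @: A).
pose c i (x : {ffun 'I_k -> V}) : R := (x @: block gamma i \in S i)%:R.
(* The factors whose index set satisfies P; they are split according to b. *)
pose part (P : pred {set 'I_k}) x : R :=
  (\prod_(A in ksets 'I_k 2 | (A != A0) && P A) q A x)
   * \prod_(i | P (block gamma i)) c i x.
have part1 P x : `|part P x| <= 1.
  rewrite normrM -[leRHS]mulr1 ler_pM // prod_le1 // => [A|i].
    exact: pair_sign_le1.
  by rewrite /c normr_nat; case: (_ \in _).
have partE (P : pred {set 'I_k}) j x v :
    (forall A, A \in ksets 'I_k 2 -> A != A0 -> P A -> j \notin A) ->
    (forall i, P (block gamma i) -> j \notin block gamma i) ->
    part P (upd x j v) = part P x.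
  move=> H1 H2; rewrite /part; congr (_ * _); apply: eq_bigr.
    by move=> A /and3P[A2 AA0 PA]; rewrite /q upd_imset // H1.
  by move=> i Pi; rewrite /c upd_imset // H2.
have := HD 'I_k a b (part (fun A => b \notin A)) (part (fun A => b \in A)) ab
  (part1 _) (part1 _).
rewrite card_ord => bil; apply: le_trans (bil _ _).
- rewrite le_eqVlt; apply/orP; left; apply/eqP; congr `|_|.
  rewrite [LHS]big_mkcond /=; apply: eq_bigr => x _.
  have -> : (if injectiveb x then pair_product D (im x) * (blocks_in gamma S x)%:R
      else 0) = (\prod_(A in ksets 'I_k 2) q A x) * \prod_i c i x.
    rewrite /c prod_bool; case: ifPn => [/pair_product_im->//|xi].
    by rewrite /q pair_signs_noninjective // mul0r.
  rewrite (bigD1 A0) /=; last by rewrite inE cards2 ab.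
  rewrite (bigID (fun A : {set 'I_k} => b \notin A)) /=.
  rewrite (bigID (fun i => b \notin block gamma i) predT) /= /part.
  have e1 : \prod_(A in ksets 'I_k 2 | (A != A0) && (b \in A)) q A x =
      \prod_(A in ksets 'I_k 2 | (A != A0) && ~~ (b \notin A)) q A x.
    by apply: eq_bigl => A; rewrite negbK.
  have e2 : \prod_(i | b \in block gamma i) c i x =
      \prod_(i | ~~ (b \notin block gamma i)) c i x.
    by apply: eq_bigl => i; rewrite negbK.
  rewrite e1 e2.
  have e3 (Q : pred {set 'I_k}) :
    \prod_(A in ksets 'I_k 2 | (A != A0) && Q A) q A x =
    \prod_(A | ((A \in ksets 'I_k 2) && (A != A0)) && Q A) q A x.
    by apply: eq_bigl => A; rewrite andbA.
  rewrite !e3; rewrite -/(q A0 x); ring.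
- by move=> x v; apply: partE.
- move=> x v; apply: partE => [A|i].
    rewrite inE => /eqP A2 AA0 bA; apply: contraNN AA0 => aA.
    by rewrite eq_sym eqEcard A2 cards2 ab leqnn andbT subUset !sub1set aA bA.
  by rewrite !inE => /eqP <-.
Qed.

(** The coefficient of the set [J] of pairs in the product over all pairs of
    [2 * y - 1]; the sets of indices that are not pairs contribute a factor
    [0 * y + 1], so that the product can be taken over all sets. *)
Definition sign_coef (K : finType) (J : {set {set K}}) : R :=
  \prod_(A : {set K}) (if A \in J then (if #|A| == 2 then 2 else 0)
                       else (if #|A| == 2 then -1 else 1)).

Definition sign_const (k : nat) : R :=
  (\sum_(J : {set {set 'I_k}}) `|sign_coef J|) * (2 * k)%:R ^+ k.

Lemma pair_signs_expand (K V : finType) (D : {set {set V}}) (x : {ffun K -> V}) :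
  injectiveb x ->
  \prod_(A in ksets K 2) pair_sign R D (x @: A) =
  \sum_(J : {set {set K}}) sign_coef J * [forall A in J, x @: A \in D]%:R.
Proof.
move=> /injectiveP ix.
transitivity (\prod_(A : {set K}) ((if #|A| == 2 then 2 else 0) * (x @: A \in D)%:R
    + (if #|A| == 2 then -1 else 1) : R)).
  rewrite big_mkcond; apply: eq_bigr => A _; rewrite inE /pair_sign card_imset //.
  by case: eqP => _; [case: (_ \in D) => /=; ring | rewrite mul0r add0r].
rewrite bigA_distr; apply: eq_bigr => J _.
rewrite /sign_coef -prod_bool -big_split; apply: eq_bigr => A _ /=.
by case: (A \in J); rewrite /= ?mulr1.
Qed.

(** Each sign is [2 * y - 1] with [y] the indicator of an edge of [D], and a product of
    such indicators is a constraint on pairs of indices, to which [colouring_disc]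
    applies since [2 <= l]. *)
Lemma pair_signs_disc (V : finType) (k l : nat) (D : {set {set V}})
    (h : {set V} -> R) (d : R) :
  (2 <= l)%N -> (l <= k)%N ->
  (forall G : {set {set V}},
    `|\sum_(T in ksets V k) h T * (clique l G T)%:R| <= d) ->
  `|\sum_(x : {ffun 'I_k -> V} | injectiveb x)
      h (im x) * \prod_(A in ksets 'I_k 2) pair_sign R D (x @: A)|
    <= sign_const k * d.
Proof.
move=> l2 lk h_disc.
have -> : \sum_(x : {ffun 'I_k -> V} | injectiveb x)
      h (im x) * \prod_(A in ksets 'I_k 2) pair_sign R D (x @: A) =
    \sum_(J : {set {set 'I_k}}) sign_coef J *
      \sum_(x : {ffun 'I_k -> V} | injectiveb x)
        h (im x) * [forall A in J, x @: A \in D]%:R.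
  under [RHS]eq_bigr do rewrite mulr_sumr.
  rewrite exchange_big; apply: eq_bigr => x xi.
  rewrite pair_signs_expand // mulr_sumr; apply: eq_bigr => J _ /=; ring.
apply: le_trans (ler_norm_sum _ _ _) _.
rewrite /sign_const -mulrA mulr_suml; apply: ler_sum => J _; rewrite normrM.
have [A /andP[AJ A2]|J2] := pickP [pred A | (A \in J) && (#|A| != 2)].
  have -> : sign_coef J = 0.
    by rewrite /sign_coef (bigD1 A) //= AJ (negPf A2) mul0r.
  by rewrite normr0 !mul0r.
apply: ler_wpM2l => //.
pose F (A : {set 'I_k}) := if A \in J then D else setT.
have := @colouring_disc R 'I_k V l h d F (ltnW l2).
rewrite !card_ord => /(_ lk h_disc).
congr (`|_| <= _); apply: eq_bigr => x _; congr (_ * (nat_of_bool _)%:R).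
apply/forallP/forallP => H A; apply/implyP => HA.
  have := J2 A; rewrite /= HA => /negbFE/eqP cA.
  by have := implyP (H A); rewrite cA /F HA; apply.
by rewrite /F; case: ifP => [/(implyP (H A))//|_]; rewrite inE.
Qed.

Lemma card_injective_ge (V : finType) (k : nat) : (0 < k)%N ->
  #|V|%:R ^+ k - (k ^ 2)%:R * rate R #|V| k
    <= #|[set x : {ffun 'I_k -> V} | injectiveb x]|%:R.
Proof.
move=> k0; have := @noninjective_le R 'I_k V; rewrite card_ord => /(_ k0).
have := cardsC [set x : {ffun 'I_k -> V} | injectiveb x].
rewrite card_ffun card_ord => e.
have -> : [set x : {ffun 'I_k -> V} | ~~ injectiveb x] =
   ~: [set x : {ffun 'I_k -> V} | injectiveb x] by apply/setP => x; rewrite !inE.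
by rewrite -natrX -e natrD lerBlDr lerD2l.
Qed.

(** [H] has density [p + e * u] where [u] is the product of the signs of pairs.  It
    satisfies [Expand] since [u] does not correlate with blocks.  If it
    satisfied [CliqueDisc p l], its deviations from [p] and from [p + e * u] would
    both have small sums against [u]; their difference is the sum of [e * u ^ 2],
    that is [e] times the number of injective tuples. *)
Lemma expand_not_clique_disc (k l : nat) (p : R) (pi : seq nat)
    (gamma : 'I_k -> 'I_(size pi)) :
  (2 <= l)%N -> (l < k)%N -> 0 < p < 1 -> (1 < size pi)%N ->
  (forall i, #|block gamma i| = nth 0%N pi i) ->
  (forall i, 0 < #|block gamma i|)%N ->
  seq_not_implies k (Expand p pi) (CliqueDisc p l).
Proof.
move=> l2 lk /andP[p0 p1] t1 gE g0.
have k0 : (0 < k)%N by apply: leq_trans lk.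
have k1 : (0 < k.-1)%N by rewrite -ltnS prednK // (leq_trans _ lk) // ltnW.
pose e := Num.min p (1 - p).
have e0 : 0 < e by rewrite lt_min p0 subr_gt0.
have [ep ep1] : e <= p /\ e <= 1 - p by rewrite !ge_min !lexx orbT.
pose P (V : finType) (H : hypergraph k V) := exists D : {set {set V}},
  (forall S : 'I_(size pi) -> {set {set V}},
    `|\sum_(x : {ffun 'I_k -> V} | injectiveb x)
        pair_product D (im x) * (blocks_in gamma S x)%:R| <= 224 * rate R #|V| k)
  /\ (forall (l' : nat) (G : {set {set V}}), (l' < k)%N ->
      `|\sum_(T in ksets V k) ((T \in edges H)%:R - (p + e * pair_product D T))
          * (clique l' G T)%:R| <= 5 * rate R #|V| k).
have [Hs HP] : exists Hs : hypergraph_seq k, forall n, P _ (graph Hs n).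
  apply: make_seq => V; have [D HD] := pair_product_blocks V.
  have w01 T : 0 <= p + e * pair_product D T <= 1.
    have := pair_product_le1 D T; rewrite ler_norml => /andP[? ?].
    by apply/andP; split; nra.
  have [E [EV HE]] := exists_disc k0 w01.
  by exists (Hypergraph EV), D; split=> // S; apply: HD.
exists Hs; split.
  pose C := 5 * (2 * k)%:R ^+ k + 224 : R.
  pose M := #|block_symmetries gamma|.
  exists (fun n => (k ^ 2)%:R * rate R n k + M%:R^-1 * C * rate R n k).
    by apply: little_o_comb; exact: rate_little_o.
  move=> n S Sk; have [D [HD HE]] := HP n.
  rewrite -mulrA -[in rate _ n _](card_vertices Hs n).
  apply: (expand_of_tuples k0 _ gE) => //; first by rewrite !ltW.
  set V := vertices Hs n; set H := graph Hs n.
  have -> : \sum_(x : {ffun 'I_k -> V} | injectiveb x)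
      ((im x \in edges H)%:R - p) * (blocks_in gamma S x)%:R =
    \sum_(x : {ffun 'I_k -> V} | injectiveb x)
      ((im x \in edges H)%:R - (p + e * pair_product D (im x)))
        * (blocks_in gamma S x)%:R +
    e * \sum_(x : {ffun 'I_k -> V} | injectiveb x)
      pair_product D (im x) * (blocks_in gamma S x)%:R.
    by rewrite mulr_sumr -big_split; apply: eq_bigr => x _ /=; ring.
  apply: le_trans (ler_normD _ _) _.
  have -> : C * rate R #|V| k =
    (2 * k)%:R ^+ k * (5 * rate R #|V| k) + 224 * rate R #|V| k by rewrite /C; ring.
  apply: lerD.
    apply: (blocks_disc S (h := fun T => (T \in edges H)%:R -
      (p + e * pair_product D T)) k1 (leq_pred k)).
      exact: block_lt.
    by move=> G; apply: HE; rewrite prednK.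
  rewrite normrM (ger0_norm (ltW e0)) -[leRHS]mul1r ler_pM ?(ltW e0) //; lra.
case=> f f0 Hf; pose C := sign_const k.
have := little_o_comb C (5 * C + e * (k ^ 2)%:R) f0 (@rate_little_o R k).
move/little_o_lt => /(_ e 0%N e0); apply=> n _; have [D [_ HE]] := HP n.
set V := vertices Hs n; set H := graph Hs n.
have cV : #|V| = n := card_vertices Hs n.
pose Q (x : {ffun 'I_k -> V}) := \prod_(A in ksets 'I_k 2) pair_sign R D (x @: A).
have b1 : `|\sum_(x : {ffun 'I_k -> V} | injectiveb x)
    ((im x \in edges H)%:R - p) * Q x| <= C * f n.
  apply: (pair_signs_disc _ (h := fun T => (T \in edges H)%:R - p) l2 (ltnW lk)).
  by apply/clique_disc_le => G; apply: Hf.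
have b2 : `|\sum_(x : {ffun 'I_k -> V} | injectiveb x)
    ((im x \in edges H)%:R - (p + e * pair_product D (im x))) * Q x|
      <= C * (5 * rate R n k).
  apply: (pair_signs_disc _ (h := fun T => (T \in edges H)%:R -
    (p + e * pair_product D T)) l2 (ltnW lk)).
  by move=> G; rewrite -[in rate _ n _]cV; apply: HE.
have b3 : \sum_(x : {ffun 'I_k -> V} | injectiveb x)
    ((im x \in edges H)%:R - p) * Q x - \sum_(x : {ffun 'I_k -> V} | injectiveb x)
    ((im x \in edges H)%:R - (p + e * pair_product D (im x))) * Q x =
    e * #|[set x : {ffun 'I_k -> V} | injectiveb x]|%:R.
  rewrite -sumrB -sum1dep_card natr_sum mulr_sumr; apply: eq_bigr => x xi.
  have sq : Q x * Q x = 1.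
    rewrite /Q -big_split big1 // => A; rewrite inE => A2.
    rewrite /pair_sign card_imset ?A2; last exact/injectiveP.
    by case: (_ \in D) => /=; rewrite ?mulrNN mulr1.
  rewrite pair_product_im // -/(Q x) -[1]sq; ring.
have := @card_injective_ge V k k0; rewrite cV => b4.
move: b1 b2 b3; set s1 := \sum_(x | _) _; set s2 := \sum_(x | _) _ => b1 b2 b3.
have b5 : e * (n%:R ^+ k - (k ^ 2)%:R * rate R n k) <= s1 - s2.
  by rewrite b3 ler_wpM2l // ltW.
have b1' := le_trans (ler_norm s1) b1.
move: b2; rewrite ler_norml => /andP[b2 _].
have -> : e * n%:R ^+ k = e * (n%:R ^+ k - (k ^ 2)%:R * rate R n k) +
  e * (k ^ 2)%:R * rate R n k by ring.
have -> : C * f n + (5 * C + e * (k ^ 2)%:R) * rate R n k =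
  C * f n + C * (5 * rate R n k) + e * (k ^ 2)%:R * rate R n k by ring.
rewrite lerD2r; lra.
Qed.

End PairProduct.

(** * Clique discrepancy does not control larger parts *)

(** Sets of at least half the vertices have at least a constant proportion of the n^r
    possible r-subsets. *)
Lemma bin_lower (n k q r : nat) : (4 * k + 2 <= n)%N -> (r <= k)%N -> (n./2 <= q)%N ->
  (n ^ r <= 4 ^ k * k`! * 'C(q, r))%N.
Proof.
move=> nk rk nq.
have step s : (s <= k)%N -> ((q - k) ^ s <= q ^_ s)%N.
  elim: s => // s IH sk; rewrite ffactnSr expnSr leq_mul ?IH ?(ltnW sk) //.
  by rewrite leq_sub2l // ltnW.
apply: (@leq_trans (4 ^ r * (q - k) ^ r)).
  have [->|r0] := posnP r; first by rewrite !expn0.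
  by rewrite -expnMn leq_exp2r //; lia.
rewrite -mulnA leq_mul ?leq_pexp2l // (leq_trans (step r rk)) //.
by rewrite -bin_ffact mulnC leq_mul2r leq_fact ?orbT.
Qed.

Section MarkedSets.
Context (R : realType) (V : finType) (X : {set V}) (D : {set {set V}}) (m : nat).

(** The sign of the trace of [T] on [X], when this trace is an m-set. *)
Definition marked (T : {set V}) : R :=
  if #|T :&: X| == m then (if T :&: X \in D then 1 else -1) else 0.

Lemma marked_le1 T : `|marked T| <= 1.
Proof.
by rewrite /marked; case: ifP => _; first case: ifP => _;
   rewrite ?normrN ?normr1 ?normr0.
Qed.

(** Fix the part [Y] of [T] outside [X].  Then [B :|: Y] is an l-clique of [G] with [B]
    inside [X] exactly when [B] is a clique of an (m-1)-graph depending on [Y],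
    because an l-subset of [B :|: Y] meets [B] in fewer than [m] points. *)
Lemma marked_disc (k l : nat) (G : {set {set V}}) (d : R) :
  (0 < l)%N -> (l < m)%N -> (m <= k)%N ->
  (forall G' : {set {set V}},
    `|\sum_(B in ksets V m) ((B \in D)%:R - 1 / 2) * (clique m.-1 G' B)%:R| <= d) ->
  `|\sum_(T in ksets V k) marked T * (clique l G T)%:R|
    <= #|V|%:R ^+ (k - m) * (2 * d).
Proof.
move=> l0 lm mk HD; have d0 : 0 <= d := le_trans (normr_ge0 _) (HD set0).
have m0 : (0 < m)%N by apply: leq_trans lm.
have lm1 : (l <= m.-1)%N by rewrite -ltnS prednK.
pose sgn (B : {set V}) : R := if B \in D then 1 else -1.
have -> : \sum_(T in ksets V k) marked T * (clique l G T)%:R =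
    \sum_(T | (T \in ksets V k) && (#|T :&: X| == m))
      sgn (T :&: X) * (clique l G T)%:R.
  rewrite [RHS]big_mkcondr; apply: eq_bigr => T _; rewrite /marked /sgn.
  by case: (_ == m); rewrite ?mul0r.
rewrite (partition_big (fun T => T :\: X) (mem (ksets V (k - m)))) /=; last first.
  by move=> T /andP[]; rewrite !inE cardsD => /eqP-> /eqP->.
apply: le_trans (ler_norm_sum _ _ _) _.
apply: (@le_trans _ _ (\sum_(Y in ksets V (k - m)) 2 * d)); last first.
  rewrite sumr_const -[leLHS]mulr_natl ler_wpM2r ?mulr_ge0 //.
  by rewrite -natrX ler_nat card_ksets_le.
apply: ler_sum => Y; rewrite inE => /eqP cY.
have [YX|YX] := boolP [disjoint X & Y]; last first.
  rewrite big1 ?normr0 ?mulr_ge0 // => T /andP[_ /eqP TY].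
  by rewrite -TY disjoint_sym disjoints_subset subsetDr in YX.
have XY0 : Y :&: X = set0 by apply/eqP; rewrite setIC setI_eq0.
rewrite (reindex_onto (fun B => B :|: Y) (fun T => T :&: X)) /=; last first.
  by move=> T /andP[_ /eqP<-]; rewrite setID.
pose G' := [set A : {set V} | (A \subset X) && clique l G (A :|: Y)].
have G'E B : B \in ksets V m ->
    clique m.-1 G' B = (B \subset X) && clique l G (B :|: Y).
  rewrite inE => /eqP cB; apply/cliqueP/andP => [H|[BX BG] A _ AB]; last first.
    rewrite inE (subset_trans AB BX); apply/cliqueP => L cL LA.
    by apply: (cliqueP _ _ _ BG) => //; apply: subset_trans LA (setSU _ AB).
  have ext (L : {set V}) : L \subset B -> (#|L| <= m.-1)%N ->
      exists A : {set V}, [/\ L \subset A, A \subset B, A \subset X & clique l G (A :|: Y)].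
    move=> LB Lm; have [|A [LA AB cA]] := exists_between LB Lm.
      by rewrite cB leq_pred.
    by have := H A cA AB; rewrite inE => /andP[]; exists A.
  split.
    apply/subsetP => v vB; have [] := ext [set v]; rewrite ?sub1set ?cards1 //.
      by apply: leq_trans lm1.
    by move=> A [vA _ /subsetP AX _]; apply: AX; rewrite -sub1set.
  apply/cliqueP => L cL LBY.
  have [||A [LA _ _ AG]] := ext (L :&: B); first exact: subsetIr.
    by rewrite (leq_trans (subset_leq_card (subsetIl _ _))) // cL.
  apply: (cliqueP _ _ _ AG) => //; apply/subsetP => v vL; rewrite inE.
  have /setUP[vB|->] := subsetP LBY v vL; last by rewrite orbT.
  by rewrite (subsetP LA) // inE vL.
have : `|2 * \sum_(B in ksets V m)
    ((B \in D)%:R - 1 / 2) * (clique m.-1 G' B)%:R| <= 2 * d.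
  by rewrite normrM ger0_norm // ler_pM2l.
congr (`|_| <= _); rewrite mulr_sumr big_mkcond [RHS]big_mkcond /=.
apply: eq_bigr => B _; case: ifP => [Bm|Bm].
  rewrite G'E //.
  have [BX|BX] := boolP (B \subset X); last first.
    rewrite mulr0 mulr0; case: ifP => // /andP[_ /eqP e].
    by rewrite -e subsetIr in BX.
  have e : (B :|: Y) :&: X = B by rewrite setIUl XY0 setU0; apply/setIidPl.
  rewrite e eqxx andbT.
  have -> : (B :|: Y) :\: X == Y.
    rewrite setDUl; have /eqP-> : B :\: X == set0 by rewrite setD_eq0.
    by rewrite set0U; apply/eqP/setDidPl; rewrite disjoint_sym.
  move: Bm; rewrite !inE => /eqP cB; rewrite cB eqxx !andbT.
  have -> : #|B :|: Y| == k.
    rewrite cardsU cB cY; have -> : B :&: Y = set0.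
      by apply/eqP; rewrite -subset0 -XY0 setIC setIS.
    by rewrite cards0 subn0 subnKC.
  by rewrite /sgn; case: (B \in D) => /=; field.
case: ifP => // /andP[/andP[/andP[_ Bm'] _] /eqP e].
by move: Bm; rewrite inE -{1}e Bm'.
Qed.

End MarkedSets.

(** The subsets of [X] are the cliques of the 1-graph [X], so a quasirandom [D] of
    density 1/2 contains about half of the m-subsets of [X]. *)
Lemma card_inside (R : realType) (V : finType) (X : {set V})
    (D : {set {set V}}) (m : nat) (d : R) :
  D \subset ksets V m ->
  `|\sum_(B in ksets V m) ((B \in D)%:R - 1 / 2)
      * (clique 1 [set A : {set V} | A \subset X] B)%:R| <= d ->
  1 / 2 * 'C(#|X|, m)%:R - d <= #|[set B in D | B \subset X]|%:R.
Proof.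
move=> DV; have GE B : clique 1 [set A : {set V} | A \subset X] B = (B \subset X).
  apply/cliqueP/subsetP => [BG v vB|BX A _ AB].
    by have := BG [set v]; rewrite cards1 inE !sub1set; apply.
  by rewrite inE; apply/subsetP => v vA; apply: BX; apply: (subsetP AB).
under eq_bigr do rewrite GE mulrBl.
rewrite sumrB -mulr_sumr.
have -> : \sum_(B in ksets V m) (B \in D)%:R * (B \subset X)%:R =
    #|[set B in D | B \subset X]|%:R :> R.
  rewrite -sum1dep_card natr_sum big_mkcond [RHS]big_mkcond.
  apply: eq_bigr => B _; case: (boolP (B \in D)) => [BD|_].
    by rewrite (subsetP DV _ BD) /= mul1r; case: (_ \subset _).
  by rewrite /= mul0r; case: ifP.
have -> : \sum_(B in ksets V m) (B \subset X)%:R = 'C(#|X|, m)%:R :> R.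
  rewrite -cards_draws -sum1dep_card natr_sum big_mkcond [RHS]big_mkcond.
  apply: eq_bigr => B _; rewrite inE andbC.
  by case: (#|B| == m) => //=; case: (_ \subset _).
by rewrite ler_norml => /andP[]; lra.
Qed.

(** [H] has density [p + e * u] with [u] the mark of a set.  [CliqueDisc p l] holds
    by [marked_disc].  For [Expand], the block [i0] is sent to the members of [D]
    inside [X] and the other blocks outside [X]: the mark is then always 1,
    and the number of edges exceeds the prediction by [e] times the number of disjoint
    tuples, which has order n^k. *)
Lemma clique_not_expand (R : realType) (k l : nat) (p : R) (pi : seq nat)
    (gamma : 'I_k -> 'I_(size pi)) (i0 : 'I_(size pi)) :
  (0 < l)%N -> (l < nth 0%N pi i0)%N -> 0 < p < 1 -> (1 < size pi)%N ->
  (forall i, #|block gamma i| = nth 0%N pi i) ->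
  (forall i, 0 < #|block gamma i|)%N ->
  seq_not_implies k (CliqueDisc p l) (Expand p pi).
Proof.
move=> l0 lm /andP[p0 p1] t1 gE g0; set m := nth 0%N pi i0.
have blt := block_lt t1 g0.
have m0 : (0 < m)%N by apply: leq_ltn_trans lm.
have mk1 : (m <= k.-1)%N by rewrite /m -gE.
have k1 : (0 < k.-1)%N by apply: leq_trans mk1.
have k0 : (0 < k)%N by apply: leq_trans (leq_pred k).
have mk : (m <= k)%N := leq_trans mk1 (leq_pred k).
pose e := Num.min p (1 - p).
have e0 : 0 < e by rewrite lt_min p0 subr_gt0.
have [ep ep1] : e <= p /\ e <= 1 - p by rewrite !ge_min !lexx orbT.
pose P (V : finType) (H : hypergraph k V) :=
  exists (X : {set V}) (D : {set {set V}}),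
  [/\ ((#|V|)./2 <= #|X|)%N, ((#|V|)./2 <= #|~: X|)%N, D \subset ksets V m,
    forall (l' : nat) (G : {set {set V}}), (l' < m)%N ->
      `|\sum_(B in ksets V m) ((B \in D)%:R - 1 / 2) * (clique l' G B)%:R|
        <= 5 * rate R #|V| m
  & forall (l' : nat) (G : {set {set V}}), (l' < k)%N ->
      `|\sum_(T in ksets V k) ((T \in edges H)%:R - (p + e * marked R X D m T))
          * (clique l' G T)%:R| <= 5 * rate R #|V| k].
have [Hs HP] : exists Hs : hypergraph_seq k, forall n, P _ (graph Hs n).
  apply: make_seq => V.
  have [||X [_ _ cX]] := @exists_between V set0 [set: V] (#|V|)./2 (sub0set _).
  - by rewrite cards0.
  - by rewrite cardsT; lia.
  have w12 (T : {set V}) : 0 <= (1 / 2 : R) <= 1 by lra.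
  have [D [DV HD]] := exists_disc m0 w12.
  have w01 T : 0 <= p + e * marked R X D m T <= 1.
    have := marked_le1 R X D m T; rewrite ler_norml => /andP[? ?].
    by clear w12 HD; apply/andP; split; nra.
  have [E [EV HE]] := exists_disc k0 w01.
  exists (Hypergraph EV), X, D; split=> //; first by rewrite cX.
  by have := cardsC X; rewrite cX; lia.
exists Hs; split.
  exists (fun n => 5 * rate R n k + e * 10 * rate R n k).
    by apply: little_o_comb; exact: rate_little_o.
  move=> n; apply/clique_disc_le => G.
  have [X [D [_ _ _ HD HE]]] := HP n.
  set V := vertices Hs n; set H := graph Hs n.
  have -> : \sum_(T in ksets V k) ((T \in edges H)%:R - p) * (clique l G T)%:R =
    \sum_(T in ksets V k) ((T \in edges H)%:R - (p + e * marked R X D m T))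
      * (clique l G T)%:R +
    e * \sum_(T in ksets V k) marked R X D m T * (clique l G T)%:R.
    by rewrite mulr_sumr -big_split; apply: eq_bigr => T _ /=; ring.
  apply: le_trans (ler_normD _ _) _.
  have cV : #|V| = n := card_vertices Hs n.
  apply: lerD.
    by rewrite -[in rate _ n _]cV; apply: HE; rewrite (leq_trans lm) // mk.
  rewrite normrM (ger0_norm (ltW e0)) -mulrA ler_pM2l //.
  have HD' : forall G' : {set {set V}}, `|\sum_(B in ksets V m)
      ((B \in D)%:R - 1 / 2) * (clique m.-1 G' B)%:R| <= 5 * rate R #|V| m.
    by move=> G'; apply: HD; rewrite prednK.
  apply: le_trans (marked_disc X G l0 lm mk HD') _.
  rewrite cV le_eqVlt; apply/orP; left; apply/eqP.
  have -> : rate R n k = rate R n m * n%:R ^+ (k - m) by rewrite rateM subnKC.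
  ring.
case=> f f0 Hf.
pose M := #|block_symmetries gamma|.
have M0 : (0 : R) < M%:R by rewrite ltr0n block_symmetries_gt0.
pose c1 : R := (4 ^ k * k`!)%:R^-1.
have c10 : 0 < c1 by rewrite invr_gt0 ltr0n muln_gt0 expn_gt0 fact_gt0.
pose c := c1 / 4.
have c0 : 0 < c by rewrite divr_gt0.
pose C := e * M%:R * (k ^ 2)%:R + 5 * (2 * k)%:R ^+ k + M%:R * (k ^ 2)%:R.
have := little_o_comb M%:R C f0 (@rate_little_o R k).
have ec0 : 0 < e * M%:R * c ^+ size pi by rewrite !mulr_gt0 ?exprn_gt0.
have /little_oP/(_ (c1 / 20)) := @rate_little_o R m.
case=> [|N HN]; first by rewrite divr_gt0.
move/little_o_lt => /(_ _ (maxn N (4 * k + 2)) ec0); apply=> n.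
rewrite geq_max => /andP[/HN rate_m n_large].
have [X [D [cX cX' DV HD HE]]] := HP n.
set V := vertices Hs n in X D cX cX' DV HD HE *; set H := graph Hs n in HE *.
have cV : #|V| = n := card_vertices Hs n.
rewrite cV in cX cX'.
have bin_ge r q : (r <= k)%N -> (n./2 <= q)%N -> c1 * n%:R ^+ r <= 'C(q, r)%:R.
  move=> rk nq; rewrite mulrC ler_pdivrMr ?ltr0n ?muln_gt0 ?expn_gt0 ?fact_gt0 //.
  by rewrite -natrX -natrM ler_nat mulnC bin_lower.
pose S i := if i == i0 then [set B in D | B \subset X]
            else [set B in ksets V (nth 0%N pi i) | B \subset ~: X].
have Sk i : S i \subset ksets V (nth 0%N pi i).
  rewrite /S; case: eqP => [->|_]; apply/subsetP => B; rewrite inE => /andP[] //.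
  by move/(subsetP DV).
have S_ge (i : 'I_(size pi)) : c * n%:R ^+ nth 0%N pi i <= #|S i|%:R.
  have nn r : 0 <= n%:R ^+ r :> R by rewrite exprn_ge0.
  rewrite /S; case: eqP => [->|_]; last first.
    apply: (@le_trans _ _ (c1 * n%:R ^+ nth 0%N pi i)).
      rewrite ler_wpM2r // /c; lra.
    apply: le_trans (bin_ge _ _ _ cX') _.
      by rewrite -gE; apply: leq_trans (blt i) (leq_pred k).
    rewrite -cards_draws ler_nat; apply: subset_leq_card; apply/subsetP => B.
    by rewrite !inE andbC.
  have lo := card_inside (X := X) DV (HD 1%N _ (leq_ltn_trans l0 lm)).
  rewrite cV in lo.
  have := bin_ge m _ mk cX; move: rate_m; rewrite ger0_norm ?rate_ge0 //.
  move: lo; rewrite -/m; set r := rate _ _ _; set b := 'C(_, _)%:R.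
  set y := #|_|%:R; rewrite /c; set z := n%:R ^+ m => ? ? ?; lra.
have prod_ge : c ^+ size pi * n%:R ^+ k <= \prod_(i < size pi) #|S i|%:R.
  have -> : c ^+ size pi * n%:R ^+ k =
      \prod_(i < size pi) (c * n%:R ^+ nth 0%N pi i).
    rewrite big_split prodr_const card_ord -expr_sum; congr (_ * _ ^+ _).
    rewrite -[LHS]card_ord -sum1_card (partition_big gamma predT) //=.
    apply: eq_bigr => i _; rewrite -gE sum1dep_card.
    by apply: eq_card => j; rewrite !inE.
  apply: ler_prod => i _; rewrite S_ge andbT mulr_ge0 ?(ltW c0) //.
  by rewrite exprn_ge0.
have p01 : 0 <= p <= 1 by rewrite !ltW.
pose psi (x : {ffun 'I_k -> V}) : R := (blocks_in gamma S x)%:R.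
pose sp : R := \sum_(x : {ffun 'I_k -> V} | injectiveb x) psi x.
pose s1 : R := \sum_(x : {ffun 'I_k -> V} | injectiveb x)
  ((im x \in edges H)%:R - p) * psi x.
pose s2 : R := \sum_(x : {ffun 'I_k -> V} | injectiveb x)
  ((im x \in edges H)%:R - (p + e * marked R X D m (im x))) * psi x.
have s12 : s1 = s2 + e * sp.
  rewrite /s1 /s2 /sp mulr_sumr -big_split; apply: eq_bigr => x xi /=.
  rewrite /psi; case: (boolP (blocks_in gamma S x)) => [/forallP xS|_]; last first.
    by rewrite !mulr0 addr0.
  have xX : im x :&: X = x @: block gamma i0.
    apply/setP => v; apply/setIP/imsetP => [[/imsetP[j _ ->] vX]|[j ji ->]].
      exists j => //; rewrite inE; apply: contraT => ne.
      have := xS (gamma j); rewrite /S (negPf ne) inE => /andP[_ /subsetP/(_ (x j))].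
      by rewrite imset_f ?inE // vX => /(_ isT).
    have := xS i0; rewrite /S eqxx inE => /andP[_ /subsetP BX].
    by split; [rewrite imset_f ?inE | apply: BX; apply: imset_f].
  have := xS i0; rewrite /S eqxx inE => /andP[xD _].
  have := subsetP DV _ xD; rewrite inE => cD.
  by rewrite /marked xX cD xD; ring.
have b2 : `|s2| <= (2 * k)%:R ^+ k * (5 * rate R n k).
  apply: (blocks_disc S (h := fun T => (T \in edges H)%:R -
      (p + e * marked R X D m T)) k1 (leq_pred k)) => //.
  by move=> G; rewrite -[in rate _ n _]cV; apply: HE; rewrite prednK.
have b1 := expand_tuplesP k0 p01 gE H Sk.
(* The count of injective tuples is the case of the edgeless hypergraph with
   density 1. *)
have b0 : M%:R * \prod_(i < size pi) #|S i|%:R - sp <= M%:R * (k ^ 2)%:R * rate R n k.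
  have := expand_tuplesP k0 _ gE (Hypergraph (sub0set (ksets V k))) Sk.
  move=> /(_ R 1); rewrite ler01 lexx => /(_ isT).
  have -> : #|edge_tuples (Hypergraph (sub0set (ksets V k))) S| = 0%N.
    by apply: eq_card0 => s; rewrite !inE /= andbF.
  have -> : \sum_(x : {ffun 'I_k -> V} | injectiveb x)
      ((im x \in edges (Hypergraph (sub0set (ksets V k))))%:R - 1)
      * (blocks_in gamma S x)%:R = - sp.
    by rewrite /sp -sumrN; apply: eq_bigr => x _; rewrite inE sub0r mulN1r.
  rewrite cV ler_norml => /andP[+ _]; rewrite -/M; lra.
have b3 := Hf n S Sk; move: b1 b3.
rewrite -/M -/s1 cV; set pr := \prod_(i < _) _; set y := #|_|%:R - _ => b1 b3.
have b4 : M%:R * y <= M%:R * f n.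
  by rewrite ler_pM2l //; apply: le_trans (ler_norm _) b3.
have b5 : e * (M%:R * (c ^+ size pi * n%:R ^+ k)) <= e * (M%:R * pr).
  by rewrite !ler_pM2l.
have b6 : e * (M%:R * pr - sp) <= e * (M%:R * (k ^ 2)%:R * rate R n k).
  by rewrite ler_pM2l.
move: b1 b2; rewrite !ler_norml => /andP[b1 _] /andP[b2 _].
have -> : e * M%:R * c ^+ size pi * n%:R ^+ k =
  e * (M%:R * (c ^+ size pi * n%:R ^+ k)) by ring.
have -> : M%:R * f n + C * rate R n k = M%:R * f n +
  e * (M%:R * (k ^ 2)%:R * rate R n k) + (2 * k)%:R ^+ k * (5 * rate R n k) +
  M%:R * (k ^ 2)%:R * rate R n k by rewrite /C; ring.
move: s12 b1 b2 b4 b5 b6.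
set u1 := e * (M%:R * (c ^+ _ * _)); set u2 := M%:R * y.
set u3 := M%:R * f n; set u4 := M%:R * (k ^ 2)%:R * rate R n k.
set u5 := (2 * k)%:R ^+ k * _.
rewrite mulrBr; set u6 := e * (M%:R * pr); set u7 := e * sp; set u8 := e * u4.
clear; move: s1 s2 u1 u2 u3 u4 u5 u6 u7 u8 => *; lra.
Qed.

Theorem theorem4 (R : realType) (k l : nat) (p : R) (pi : seq nat)
    (hk : (2 <= k)%N) (hp0 : 0 < p) (hp1 : p < 1)
    (hl1 : (1 <= l)%N) (hlk : (l <= k - 1)%N)
    (hpi : proper_partition k pi) :
  [/\ seq_implies k (CliqueDisc p l) (Expand p pi)
        <-> (forall ki, ki \in pi -> (ki <= l)%N),
      seq_implies k (Expand p pi) (CliqueDisc p 1)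
    & (2 <= l)%N -> seq_not_implies k (Expand p pi) (CliqueDisc p l)].
Proof.
have /and3P[t1 pi0 /eqP pik] := hpi.
have [gamma gE] : exists gamma : 'I_k -> 'I_(size pi),
    forall i, #|block gamma i| = nth 0%N pi i.
  by rewrite -pik; exact: exists_blocks.
have g0 i : (0 < #|block gamma i|)%N.
  by rewrite gE; apply: (allP pi0); apply: mem_nth.
have k0 : (0 < k)%N by apply: ltnW.
have lk : (l < k)%N by move: hlk; rewrite subn1 -ltnS prednK.
have p01 : 0 <= p <= 1 by rewrite !ltW.
have p01' : 0 < p < 1 by rewrite hp0.
split.
- split=> [imp ki /(nthP 0%N)[i i_lt <-]|pil].
    rewrite leqNgt; apply/negP => lt_l.
    have [Hs [HC HE]] := @clique_not_expand R k l p pi gamma (Ordinal i_lt)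
      hl1 lt_l p01' t1 gE g0.
    exact: HE (imp Hs HC).
  by move=> Hs; apply: (clique_disc_expand k0 p01 gE hl1 (ltnW lk)).
- by move=> Hs; apply: (expand_clique_disc1 k0 p01 gE).
- by move=> l2; apply: (expand_not_clique_disc l2 lk p01' t1 gE g0).
Qed.
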